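(* In the triangular-array setting (for each $n$, an independent trajectory $H^n_{m_n}$ of length $m_n$ generated by the adaptive linear Gaussian sampling procedure with sampling rule $\Lambda^n$, with the same true $\beta_0\in\mathbb{R}^p$, variance $\sigma^2>0$ and prior $\pi$ for all $n$), let $\mathbf{X}_n$ be the $m_n\times p$ matrix with rows $(x^n_j)^\top$, $\mathbf{y}_n=(y^n_1,\dots,y^n_{m_n})^\top$, and $\hat\beta_n=(\mathbf{X}_n^\top\mathbf{X}_n)^{-1}\mathbf{X}_n^\top\mathbf{y}_n$. Assume: (i) each $x^n_j\in\{e_1,\dots,e_p\}$; (ii) $\lambda_{\min}(\mathbf{X}_n^\top\mathbf{X}_n)\xrightarrow{p}\infty$; (iii) $\pi$ is a continuous and bounded density on $\mathbb{R}^p$ with $\pi(\beta_0)>0$. Then $$\big\|\pi(\cdot\mid H^n_{m_n})-\mathcal{N}\big(\hat\beta_n,\sigma^2(\mathbf{X}_n^\top\mathbf{X}_n)^{-1}\big)\big\|_{\mathrm{TV}}\xrightarrow{p}0.$$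
   Context: Adaptive linear Gaussian sampling procedure: given a covariate sampling rule $\Lambda$ that maps any finite history $H_{j-1}=((x_1,y_1),\dots,(x_{j-1},y_{j-1}))$ to a probability distribution $\Lambda(\cdot\mid H_{j-1})$ on $\mathbb{R}^p$, a coefficient vector $\beta$ and known variance $\sigma^2>0$, set $H_0=\emptyset$ and for $j=1,2,\dots$: draw $x_j\sim\Lambda(\cdot\mid H_{j-1})$, then $y_j\sim\mathcal{N}(x_j^\top\beta,\sigma^2)$ conditionally on the past and $x_j$, and set $H_j=((x_1,y_1),\dots,(x_j,y_j))$. The posterior is $\pi(\beta\mid H^n_{m_n})\propto\pi(\beta)\prod_{j=1}^{m_n}\exp\!\big(-(y^n_j-(x^n_j)^\top\beta)^2/(2\sigma^2)\big)$. $\|\cdot\|_{\mathrm{TV}}$ is total variation distance; $\lambda_{\min}$ the smallest eigenvalue. *)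

(* Defs.v *)
From HB Require Import structures.
From mathcomp Require Import all_boot all_order all_algebra.
From mathcomp Require Import all_classical all_reals all_analysis.
Set Implicit Arguments. Unset Strict Implicit. Unset Printing Implicit Defensive.
Import Order.TTheory GRing.Theory Num.Theory.
Import numFieldNormedType.Exports.
Local Open Scope classical_set_scope.
Local Open Scope ring_scope.

Section Defs.
Variable R : realType.

(* ---------- R^p : vectors are row vectors 'rV[R]_p; measurable structure and
   Lebesgue integration are taken on p.-tuple R (product sigma-algebra of the
   library), with the obvious identification. ---------- *)

Definition tup2row (p : nat) (v : p.-tuple R) : 'rV[R]_p := \row_i tnth v i.

(* iterated Lebesgue integral over R^k of an (extended) function of k.-tuples
   (by Tonelli it is the integral w.r.t. k-dimensional Lebesgue measure for
   nonnegative measurable integrands) *)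
Fixpoint iint (k : nat) : (k.-tuple R -> \bar R) -> \bar R :=
  match k with
  | 0 => fun F => F [tuple]
  | k'.+1 => fun F =>
      (\int[lebesgue_measure]_t iint (fun v : k'.-tuple R => F (cons_tuple t v)))%E
  end.

Definition Rp_integral (p : nat) (F : 'rV[R]_p -> \bar R) : \bar R :=
  iint (fun v : p.-tuple R => F (tup2row v)).

Definition dens_measure (p : nat) (f : 'rV[R]_p -> R) (A : set (p.-tuple R)) : \bar R :=
  iint (fun v : p.-tuple R => ((\1_A v : R) * f (tup2row v))%:E).

Definition tv_dist (p : nat) (f g : 'rV[R]_p -> R) : \bar R :=
  ereal_sup [set `|(dens_measure f A - dens_measure g A)%E|%E
            | A in [set A : set (p.-tuple R) | measurable A]].

Definition gauss_density (p : nat) (mu : 'rV[R]_p) (S : 'M[R]_p) (b : 'rV[R]_p) : R :=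
  (Num.sqrt (pi *+ 2) ^- p) * (Num.sqrt (\det S))^-1 *
  expR (- ((b - mu) *m invmx S *m (b - mu)^T) ord0 ord0 / 2).

Definition lambda_min (p : nat) (A : 'M[R]_p) : R := inf [set a : R | eigenvalue A a].

Definition likelihood (m p : nat) (sigma : R) (Xm : 'M[R]_(m, p)) (y : 'cV[R]_m)
    (b : 'rV[R]_p) : R :=
  \prod_(j < m) expR (- (y j ord0 - (row j Xm *m b^T) ord0 ord0) ^+ 2 / (sigma ^+ 2 *+ 2)).

Definition posterior (m p : nat) (sigma : R) (prior : 'rV[R]_p -> R)
    (Xm : 'M[R]_(m, p)) (y : 'cV[R]_m) (b : 'rV[R]_p) : R :=
  prior b * likelihood sigma Xm y b /
  fine (Rp_integral (fun c => (prior c * likelihood sigma Xm y c)%:E)).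

Section Array.
Context {d : measure_display} (Omega : nat -> measurableType d)
  (P : forall n, probability (Omega n) R) (p : nat) (m : nat -> nat)
  (X : forall n, nat -> Omega n -> 'I_p)   (* x^n_j = e_(X n j) *)
  (Y : forall n, nat -> Omega n -> R).

(* history H^n_j = ((x_1,y_1),...,(x_j,y_j)) (0-based: entries 0..j-1) *)
Definition history n j (w : Omega n) : seq ('I_p * R) :=
  map (fun k => pair (@X n k w) (@Y n k w)) (iota 0 j).

Definition history_sigma n j : set (set (Omega n)) :=
  <<s [set A | exists k a (C : set R), (k < j)%N /\ measurable C /\
         A = [set w | @X n k w = a /\ C (@Y n k w)]] >>.

Definition design n (w : Omega n) : 'M[R]_(m n, p) :=
  \matrix_(j < m n, k < p) ((@X n j w == k)%:R).
Definition response n (w : Omega n) : 'cV[R]_(m n) := \col_(j < m n) @Y n j w.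
Definition gram n (w : Omega n) : 'M[R]_p := (@design n w)^T *m @design n w.
Definition ols n (w : Omega n) : 'rV[R]_p :=
  (invmx (@gram n w) *m (@design n w)^T *m @response n w)^T.

(* Adaptive linear Gaussian sampling procedure with sampling rules Lambda n
   (covariates restricted to {e_1..e_p}, so Lambda n h is a probability vector
   on 'I_p): conditionally on H_{j-1}, x_j ~ Lambda(.|H_{j-1}); conditionally on
   H_{j-1} and x_j, y_j ~ N(x_j^T beta0, sigma^2). *)
Definition adaptive_gaussian_sampling (Lambda : forall n, seq ('I_p * R) -> 'I_p -> R)
    (beta0 : 'rV[R]_p) (sigma : R) : Prop :=
  forall n,
  [/\ (forall h i, 0 <= Lambda n h i) /\ (forall h, \sum_i Lambda n h i = 1),
      (forall j a, measurable [set w | @X n j w = a]) /\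
        (forall j, measurable_fun setT (@Y n j)),
      forall j i (B : set R), measurable B ->
        @history_sigma n j ((fun w => Lambda n (@history n j w) i) @^-1` B) &
      forall j i (C : set R) (A : set (Omega n)), (j < m n)%N -> measurable C ->
        @history_sigma n j A ->
        P n (A `&` [set w | @X n j w = i /\ C (@Y n j w)]) =
        ((\int[P n]_(w in A) (Lambda n (@history n j w) i)%:E) *
          normal_prob (beta0 ord0 i) sigma C)%E].

End Array.
End Defs.

(* Main.v *)
(** In the basis [e_1, ..., e_p] the Gram matrix is diagonal, with the pull counts [N_k]
    on the diagonal, so the Gaussian approximation [g] is a product of one-dimensional
    normal densities and the posterior is [prior * g / Z].  The prior differs from
    [prior beta0] by at most a small constant plus a sum of exponentials of
    [+- l (b_k - beta0_k)] (continuity near [beta0], boundedness elsewhere).  Integrated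
    against [g] these exponentials are explicit, and small as soon as every [N_k] is large
    and every arm mean is close to [beta0_k]; this bounds the total variation distance.

    For the arm means, adaptivity is handled by the exponential martingale
    [exp (l S_k - l^2 sigma^2 N_k / 2)], with [S_k] the sum of the centred rewards of
    arm [k]: it has expectation 1 whatever the sampling rule, so Markov's inequality
    bounds the probability of [delta N_k < |S_k|] and [L <= N_k] by
    [2 exp (- delta^2 L / (2 sigma^2))], uniformly in the length of the trajectory.

    A measure takes arbitrary values on nonmeasurable sets, so the event of the theorem must
    be shown measurable; Scheffe's formula turns the supremum over events defining the total
    variation distance into the integral of a jointly measurable function. *)
Require Import Defs.
From HB Require Import structures.
From mathcomp Require Import all_boot all_order all_algebra.
From mathcomp Require Import all_classical all_reals all_analysis.
From mathcomp Require Import measurable_realfun ring lra.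
Import Order.TTheory GRing.Theory Num.Theory.
Import numFieldNormedType.Exports.
Local Open Scope classical_set_scope.
Local Open Scope ring_scope.

Set Implicit Arguments.
Unset Strict Implicit.
Unset Printing Implicit Defensive.

(** * Measurability, monotonicity and linearity of the iterated Lebesgue integral *)

Section IteratedIntegral.
Variable R : realType.
Local Open Scope ereal_scope.

Lemma measurable_cons_section d (T : measurableType d) k
    (F : T * k.+1.-tuple R -> \bar R) :
  measurable_fun setT F ->
  measurable_fun setT
    (fun z : (T * R) * k.-tuple R => F (z.1.1, cons_tuple z.1.2 z.2)).
Proof.
move=> mF.
apply: (measurableT_comp mF); apply/measurable_fun_pairP; split => /=.
  exact: (measurableT_comp measurable_fst measurable_fst).
rewrite (_ : snd \o _ = fun z : (T * R) * k.-tuple R =>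
   [the k.+1.-tuple R of z.1.2 :: z.2]).
  apply: (@measurable_cons _ _ _ _ (fun z : (T * R) * k.-tuple R => z.1.2) k snd) => //.
  exact: (measurableT_comp measurable_snd measurable_fst).
by apply/funext => z /=; apply/val_inj.
Qed.

Lemma iint_ge0 k (F : k.-tuple R -> \bar R) :
  (forall v, 0 <= F v) -> 0 <= iint F.
Proof.
elim: k F => [|k IH] F F0 /=; first exact: F0.
by apply: integral_ge0 => t _; apply: IH => v.
Qed.

(** The parameter space [T] is arbitrary because the induction on [k] moves the first coordinate of
    the tuple into it, replacing [T] by [T * R]; Tonelli then integrates that coordinate out. *)
Lemma measurable_iint d (T : measurableType d) k (F : T * k.-tuple R -> \bar R) :
  (forall z, 0 <= F z) -> measurable_fun setT F ->
  measurable_fun setT (fun x => iint (fun v => F (x, v))).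
Proof.
elim: k d T F => [|k IH] d T F F0 mF /=.
  by apply: (measurableT_comp mF); exact: pair2_measurable.
apply: (@measurable_fun_fubini_tonelli_F _ _ _ _ R lebesgue_measure
  (fun z : T * R => iint (fun v => F (z.1, cons_tuple z.2 v)))); last first.
  by move=> z; apply: iint_ge0 => v.
by apply: (IH _ _ (fun z => F (z.1.1, cons_tuple z.1.2 z.2))) => //;
  exact: measurable_cons_section.
Qed.

Lemma measurable_cons_slice k (F : k.+1.-tuple R -> \bar R) t :
  measurable_fun setT F -> measurable_fun setT (fun v => F (cons_tuple t v)).
Proof.
move=> mF; apply: (measurableT_comp mF).
apply: (@measurable_cons _ _ _ _ (cst t) k id) => //; exact: measurable_id.
Qed.

Lemma measurable_iint_slice k (F : k.+1.-tuple R -> \bar R) :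
  (forall v, 0 <= F v) -> measurable_fun setT F ->
  measurable_fun setT (fun t => iint (fun v => F (cons_tuple t v))).
Proof.
move=> F0 mF.
apply: (@measurable_iint _ _ k (fun z => F (cons_tuple z.1 z.2))) => //.
apply: (measurableT_comp mF).
by apply: (@measurable_cons _ _ _ _ fst k snd).
Qed.

Lemma le_iint k (F G : k.-tuple R -> \bar R) :
  (forall v, 0 <= F v) -> measurable_fun setT F -> measurable_fun setT G ->
  (forall v, F v <= G v) -> iint F <= iint G.
Proof.
elim: k F G => [|k IH] F G F0 mF mG FG /=; first exact: FG.
have G0 v : 0 <= G v by exact: le_trans (FG v).
apply: ge0_le_integral => //.
- by move=> t _; apply: iint_ge0 => v.
- exact: measurable_iint_slice.
- exact: measurable_iint_slice.
- by move=> t _; apply: IH => //; exact: measurable_cons_slice.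
Qed.

Lemma eq_iint k (F G : k.-tuple R -> \bar R) : F =1 G -> iint F = iint G.
Proof. by move/funext => ->. Qed.

Lemma iintD k (F G : k.-tuple R -> \bar R) :
  (forall v, 0 <= F v) -> measurable_fun setT F ->
  (forall v, 0 <= G v) -> measurable_fun setT G ->
  iint (fun v => F v + G v) = iint F + iint G.
Proof.
elim: k F G => [//|k IH] F G F0 mF G0 mG /=.
rewrite -ge0_integralD//; first last.
- exact: measurable_iint_slice.
- by move=> t _; apply: iint_ge0 => v.
- exact: measurable_iint_slice.
- by move=> t _; apply: iint_ge0 => v.
by apply: eq_integral => t _; apply: IH => //; exact: measurable_cons_slice.
Qed.

Lemma iintZl k (c : R) (F : k.-tuple R -> \bar R) : (0 <= c)%R ->
  (forall v, 0 <= F v) -> measurable_fun setT F ->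
  iint (fun v => c%:E * F v) = c%:E * iint F.
Proof.
move=> c0; elim: k F => [//|k IH] F F0 mF /=.
rewrite -ge0_integralZl_EFin//; first last.
- exact: measurable_iint_slice.
- by move=> t _; apply: iint_ge0 => v.
by apply: eq_integral => t _; apply: IH => //; exact: measurable_cons_slice.
Qed.

Lemma iint_sum k (I : Type) (r : seq I) (F : I -> k.-tuple R -> \bar R) :
  (forall i v, 0 <= F i v) -> (forall i, measurable_fun setT (F i)) ->
  iint (fun v => \sum_(i <- r) F i v) = \sum_(i <- r) iint (F i).
Proof.
move=> F0 mF; elim: r => [|i r IH].
  rewrite big_nil -[RHS](mul0e (iint (fun _ : k.-tuple R => 0))) -iintZl//.
  by apply: eq_iint => v; rewrite big_nil mul0e.
rewrite big_cons -IH -iintD//; first by apply: eq_iint => v; rewrite big_cons.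
- by move=> v; exact: sume_ge0.
- exact: emeasurable_sum.
Qed.

(** A positive weight creates no new null functions. This will give the positivity of the
    normalizing constants. *)
Lemma iint_mul_eq0 k (F : k.-tuple R -> \bar R) (h : k.-tuple R -> R) :
  (forall v, 0 <= F v) -> measurable_fun setT F ->
  (forall v, 0 < h v)%R -> measurable_fun setT h ->
  iint (fun v => (h v)%:E * F v) = 0 -> iint F = 0.
Proof.
elim: k F h => [|k IH] F h F0 mF h0 mh /=.
  move=> /eqP; rewrite mule_eq0 => /orP[|/eqP//].
  by rewrite eqe gt_eqF.
have hF0 v : 0 <= (h v)%:E * F v by rewrite mule_ge0// lee_fin ltW.
have mhF : measurable_fun setT (fun v => (h v)%:E * F v).
  by apply: emeasurable_funM => //; exact/measurable_EFinP.
move=> I0.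
(* A nonnegative outer integrand with zero integral vanishes for almost every first coordinate, and
   at each such coordinate the induction hypothesis applies. *)
have := (ae_eq_integral_abs lebesgue_measure measurableT
   (measurable_iint_slice hF0 mhF)).1.
have -> : \int[lebesgue_measure]_t
    `|iint (fun v : k.-tuple R => (h (cons_tuple t v))%:E * F (cons_tuple t v))| = 0.
  rewrite -[RHS]I0; apply: eq_integral => t _.
  by rewrite gee0_abs// iint_ge0.
move=> /(_ erefl) ae0.
rewrite -[RHS](@integral0_eq _ _ _ lebesgue_measure setT (cst 0))//.
apply: ge0_ae_eq_integral => //.
- exact: measurable_iint_slice.
- by move=> t _; apply: iint_ge0 => v.
apply: filterS ae0 => t /= H _; have := H I.
apply: IH => //; first exact: measurable_cons_slice.
apply/measurable_EFinP; apply: (@measurable_cons_slice k (EFin \o h)).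
exact/measurable_EFinP.
Qed.

End IteratedIntegral.

(** * Total variation distance between densities and Scheffe's formula *)

Section Densities.
Variables (R : realType) (p : nat).
Implicit Types (f g : 'rV[R]_p -> R) (A : set (p.-tuple R)).

Lemma measurable_tup_EFin (h : p.-tuple R -> R) :
  measurable_fun setT h -> measurable_fun setT (fun v => (h v)%:E).
Proof. by move=> mh; exact/measurable_EFinP. Qed.

(** Integrates the pointwise identity f + (g - f)^+ = g + (f - g)^+ over [A]. Sums on both sides
    avoid subtracting infinite values. *)
Lemma dens_measure_pos_part f g A :
  (forall b, 0 <= f b) -> (forall b, 0 <= g b) ->
  measurable_fun setT (f \o @tup2row R p) ->
  measurable_fun setT (g \o @tup2row R p) -> measurable A ->
  (dens_measure f A + dens_measure (fun b => Num.max (g b - f b) 0)%R A =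
   dens_measure g A + dens_measure (fun b => Num.max (f b - g b) 0)%R A)%E.
Proof.
move=> f0 g0 mf mg mA; rewrite /dens_measure.
have m1A : measurable_fun setT (\1_A : p.-tuple R -> R) by exact: measurable_indic.
have m1 h : measurable_fun setT (h \o @tup2row R p) ->
  measurable_fun setT (fun v => ((\1_A v : R) * h (tup2row v))%:E).
  by move=> mh; apply: measurable_tup_EFin; exact: measurable_funM.
have mpos (u w : 'rV[R]_p -> R) : measurable_fun setT (u \o @tup2row R p) ->
    measurable_fun setT (w \o @tup2row R p) ->
    measurable_fun setT ((fun b => Num.max (u b - w b) 0) \o @tup2row R p).
  move=> mu mw; apply: measurable_maxr => //; exact: measurable_funB.
have i0 v : 0 <= \1_A v :> R by rewrite indicE.
have addE (u w : 'rV[R]_p -> R) : (forall b, 0 <= u b) -> (forall b, 0 <= w b) ->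
    measurable_fun setT (u \o @tup2row R p) ->
    measurable_fun setT (w \o @tup2row R p) ->
    (iint (fun v => ((\1_A v : R) * u (tup2row v))%:E) +
     iint (fun v => ((\1_A v : R) * w (tup2row v))%:E) =
     iint (fun v => ((\1_A v : R) * (u (tup2row v) + w (tup2row v)))%:E))%E.
  move=> u0 w0 mu mw; rewrite -iintD.
  - by apply: eq_iint => v; rewrite -EFinD mulrDr.
  - by move=> v; rewrite lee_fin mulr_ge0.
  - exact: m1.
  - by move=> v; rewrite lee_fin mulr_ge0.
  - exact: m1.
have max0 (x : R) : 0 <= Num.max x 0 by rewrite le_max lexx orbT.
rewrite (addE f (fun b => Num.max (g b - f b) 0))//; last exact: mpos.
rewrite (addE g (fun b => Num.max (f b - g b) 0))//; last exact: mpos.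
apply: eq_iint => v; congr (_ * _)%:E.
by rewrite /Num.max; case: ltP => ?; case: ltP => ?; lra.
Qed.

Lemma le_dens_measure f g A :
  (forall b, 0 <= f b) ->
  measurable_fun setT (f \o @tup2row R p) ->
  measurable_fun setT (g \o @tup2row R p) -> measurable A ->
  (forall b, f b <= g b) ->
  (dens_measure f A <= dens_measure g setT)%E.
Proof.
move=> f0 mf mg mA fg; apply: le_iint.
- by move=> v; rewrite lee_fin mulr_ge0// indicE.
- by apply: measurable_tup_EFin; apply: measurable_funM => //; exact: measurable_indic.
- by apply: measurable_tup_EFin; apply: measurable_funM => //; exact: measurable_indic.
- move=> v; rewrite lee_fin [X in _ <= X * _]indicE in_setT mul1r.
  by rewrite indicE; case: (v \in A); rewrite ?mul1r ?mul0r// (le_trans (f0 _) (fg _)).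
Qed.

Lemma dens_measure_ge0 f A : (forall b, 0 <= f b) -> (0 <= dens_measure f A)%E.
Proof.
by move=> f0; apply: iint_ge0 => v; rewrite lee_fin mulr_ge0// indicE.
Qed.

Lemma dens_measureT f : dens_measure f setT = Rp_integral (fun b => (f b)%:E).
Proof. by apply: eq_iint => v; rewrite indicE in_setT mul1r. Qed.

(* Scheffe: the supremum is attained at the set [g < f]. *)
Lemma tv_dist_pos_part f g :
  (forall b, 0 <= f b) -> (forall b, 0 <= g b) ->
  measurable_fun setT (f \o @tup2row R p) ->
  measurable_fun setT (g \o @tup2row R p) ->
  Rp_integral (fun b => (f b)%:E) = 1%E ->
  Rp_integral (fun b => (g b)%:E) = 1%E ->
  tv_dist f g = Rp_integral (fun b => (Num.max (f b - g b) 0)%:E).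
Proof.
move=> f0 g0 mf mg f1 g1.
pose fg b : R := Num.max (f b - g b) 0; pose gf b : R := Num.max (g b - f b) 0.
have fg0 b : 0 <= fg b by rewrite le_max lexx orbT.
have gf0 b : 0 <= gf b by rewrite le_max lexx orbT.
have mpos (u w : 'rV[R]_p -> R) : measurable_fun setT (u \o @tup2row R p) ->
    measurable_fun setT (w \o @tup2row R p) ->
    measurable_fun setT ((fun b => Num.max (u b - w b) 0) \o @tup2row R p).
  move=> mu mw; apply: measurable_maxr => //; exact: measurable_funB.
have mfg : measurable_fun setT (fg \o @tup2row R p) by exact: mpos.
have mgf : measurable_fun setT (gf \o @tup2row R p) by exact: mpos.
have fin (h : 'rV[R]_p -> R) A : (forall b, 0 <= h b) ->
    measurable_fun setT (h \o @tup2row R p) ->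
    measurable A -> (dens_measure h setT <= 1)%E -> dens_measure h A \is a fin_num.
  move=> h0 mh mA h1; rewrite ge0_fin_numE ?dens_measure_ge0//.
  by rewrite (le_lt_trans (le_dens_measure h0 mh mh mA (fun=> lexx _)))//
     (le_lt_trans h1)// ltry.
have fgT1 : (dens_measure fg setT <= 1)%E.
  rewrite -f1 -dens_measureT; apply: le_dens_measure => // b.
  by rewrite ge_max f0 andbT lerBlDr lerDl.
have gfT1 : (dens_measure gf setT <= 1)%E.
  rewrite -g1 -dens_measureT; apply: le_dens_measure => // b.
  by rewrite ge_max g0 andbT lerBlDr lerDl.
have fE A : measurable A -> dens_measure f A \is a fin_num.
  by move=> mA; apply: fin => //; rewrite dens_measureT f1.
have gE A : measurable A -> dens_measure g A \is a fin_num.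
  by move=> mA; apply: fin => //; rewrite dens_measureT g1.
have fgE A : measurable A -> dens_measure fg A \is a fin_num.
  by move=> mA; exact: fin.
have gfE A : measurable A -> dens_measure gf A \is a fin_num.
  by move=> mA; exact: fin.
rewrite -dens_measureT -/fg.
have eqA A (mA : measurable A) := dens_measure_pos_part f0 g0 mf mg mA.
(* As [f] and [g] have the same mass 1, their two positive parts have equal mass. *)
have eqT : dens_measure fg setT = dens_measure gf setT.
  have := eqA _ measurableT; rewrite -/fg -/gf !dens_measureT f1 g1 -!dens_measureT.
  rewrite -(fineK (fgE _ measurableT)) -(fineK (gfE _ measurableT)) -!EFinD.
  by move=> [] /addrI ->.
have diff A (mA : measurable A) : fine (dens_measure f A) - fine (dens_measure g A) =
    fine (dens_measure fg A) - fine (dens_measure gf A).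
  have := congr1 fine (eqA A mA); rewrite -/fg -/gf.
  by rewrite !fineD ?fE ?gE ?fgE ?gfE//; lra.
apply/eqP; rewrite eq_le; apply/andP; split.
  apply: ub_ereal_sup => _ [A mA <-] /=.
  rewrite -(fineK (fE A mA)) -(fineK (gE A mA)) -EFinB abse_EFin diff//.
  (* Both terms of the difference lie between 0 and the common mass of the positive parts, so this
     mass bounds its absolute value. *)
  have hfg := le_dens_measure fg0 mfg mfg mA (fun=> lexx _).
  have := le_dens_measure gf0 mgf mgf mA (fun=> lexx _); rewrite -eqT.
  move: hfg; have := dens_measure_ge0 A fg0; have := dens_measure_ge0 A gf0.
  rewrite -(fineK (fgE A mA)) -(fineK (gfE A mA)) -(fineK (fgE _ measurableT)).
  rewrite !lee_fin /= => *; rewrite ler_norml; apply/andP; split; lra.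
pose As : set (p.-tuple R) := [set v | g (tup2row v) < f (tup2row v)].
have mAs : measurable As.
  rewrite -[As]setTI.
  have := measurable_fun_ltr mg mf measurableT (Y := [set true]).
  by apply.
apply: ereal_sup_ubound; exists As => //=.
rewrite -(fineK (fE _ mAs)) -(fineK (gE _ mAs)) -EFinB diff//.
have -> : dens_measure gf As = dens_measure (fun=> 0) As.
  apply: eq_iint => v; rewrite mulr0 indicE.
  case: (boolP (v \in As)) => [|]; last by rewrite mul0r.
  rewrite inE /As /= => gltf; rewrite mul1r /gf /Num.max.
  by case: ifPn => //; rewrite -leNgt => ?; congr EFin; lra.
have -> : dens_measure fg As = dens_measure fg setT.
  apply: eq_iint => v; rewrite [in RHS]indicE in_setT mul1r indicE.
  case: (boolP (v \in As)) => [|]; first by rewrite mul1r.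
  rewrite notin_setE /As /= => /negP; rewrite -leNgt => gltf.
  rewrite mul0r /fg /Num.max.
  by case: ifPn => //; rewrite -leNgt => ?; congr EFin; lra.
have -> : dens_measure (fun=> 0) As = 0%E.
  rewrite -[RHS](mul0e (dens_measure (fun=> 0) As)) -iintZl//.
  - by apply: eq_iint => v; rewrite mulr0 mul0e.
  - by apply: measurable_tup_EFin; apply: measurable_funM => //; exact: measurable_indic.
by rewrite subr0 fineK ?fgE// gee0_abs ?dens_measure_ge0.
Qed.

End Densities.

(** * Products of one-dimensional normal densities and their exponential moments *)

Section GaussianProduct.
Variable R : realType.

Definition gauss_prod p (mu s : 'I_p -> R) (b : 'rV[R]_p) : R :=
  \prod_i normal_pdf (mu i) (s i) (b ord0 i).

Lemma tup2rowE p (v : p.-tuple R) i : tup2row v ord0 i = tnth v i.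
Proof. by rewrite mxE. Qed.

Lemma measurable_tup2row_coord p i :
  measurable_fun setT (fun v : p.-tuple R => tup2row v ord0 i).
Proof.
rewrite (_ : (fun _ => _) = (@tnth p R)^~ i); last first.
  by apply/funext => v; rewrite tup2rowE.
exact: measurable_tnth.
Qed.

Lemma gauss_prod_ge0 p (mu s : 'I_p -> R) b : 0 <= gauss_prod mu s b.
Proof. by apply: prodr_ge0 => i _; exact: normal_pdf_ge0. Qed.

Lemma measurable_gauss_prod p (mu s : 'I_p -> R) :
  measurable_fun setT (gauss_prod mu s \o @tup2row R p).
Proof.
rewrite /gauss_prod /comp; apply: measurable_prod => i _.
apply: measurableT_comp; first exact: measurable_normal_pdf.
exact: measurable_tup2row_coord.
Qed.

Lemma Rp_integral_gauss_prod p (mu s : 'I_p -> R) :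
  Rp_integral (fun b => (gauss_prod mu s b)%:E) = 1%E.
Proof.
rewrite /Rp_integral.
elim: p mu s => [|p IH] mu s; first by rewrite /= /gauss_prod big_ord0.
rewrite /= -[RHS](integral_normal_pdf (mu ord0) (s ord0)).
apply: eq_integral => t _.
rewrite -[RHS]mule1 -(IH (mu \o lift ord0) (s \o lift ord0)) -iintZl.
- apply: eq_iint => v; rewrite -EFinM /gauss_prod big_ord_recl.
  congr (normal_pdf _ _ _ * _)%:E; first by rewrite tup2rowE.
  by apply: eq_bigr => i _; rewrite !tup2rowE/= tnthS.
- exact: normal_pdf_ge0.
- by move=> v; rewrite lee_fin gauss_prod_ge0.
- by apply: measurable_tup_EFin; exact: measurable_gauss_prod.
Qed.

(* completing the square *)
Lemma normal_pdf_tilt (mu s l a x : R) : s != 0 ->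
  normal_pdf mu s x * expR (l * (x - a)) =
  expR (l * (mu - a) + l ^+ 2 * s ^+ 2 / 2) * normal_pdf (mu + l * s ^+ 2) s x.
Proof.
move=> s0; rewrite !normal_pdfE//= /normal_fun.
rewrite -[LHS]mulrA -expRD [RHS]mulrCA -expRD; congr (_ * expR _).
by field.
Qed.

Lemma gauss_prod_tilt p (mu s : 'I_p -> R) k (l a : R) b : s k != 0 ->
  gauss_prod mu s b * expR (l * (b ord0 k - a)) =
  expR (l * (mu k - a) + l ^+ 2 * s k ^+ 2 / 2) *
  gauss_prod (fun i => if i == k then mu k + l * s k ^+ 2 else mu i) s b.
Proof.
move=> sk; rewrite /gauss_prod (bigD1 k)//= mulrAC normal_pdf_tilt// -[LHS]mulrA.
rewrite [in RHS](bigD1 k)//= eqxx; congr (_ * (_ * _)).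
by apply: eq_bigr => i /negbTE ->.
Qed.

(** The Gaussian moment generating function: an exponential tilt along coordinate [k] only shifts
    the mean there, and the shifted product again integrates to 1. *)
Lemma Rp_integral_gauss_prod_exp p (mu s : 'I_p -> R) k (l a : R) : s k != 0 ->
  Rp_integral (fun b => (gauss_prod mu s b * expR (l * (b ord0 k - a)))%:E) =
  (expR (l * (mu k - a) + l ^+ 2 * s k ^+ 2 / 2))%:E.
Proof.
move=> sk; rewrite -[RHS]mule1.
rewrite -(Rp_integral_gauss_prod
   (fun i => if i == k then mu k + l * s k ^+ 2 else mu i) s).
rewrite /Rp_integral -iintZl ?expR_ge0//.
- by apply: eq_iint => v; rewrite gauss_prod_tilt.
- by move=> v; rewrite lee_fin gauss_prod_ge0.
- by apply: measurable_tup_EFin; exact: measurable_gauss_prod.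
Qed.

End GaussianProduct.

(** * Measurability of continuous functions for the product sigma-algebra *)

Section ContinuousMeasurable.
Variables (R : realType) (p : nat).

(** Rounding down to the lattice of mesh 1/(n+1): [grid] gives the integer label of the cell
    containing [v], and [node] the lower corner of a cell. *)
Let grid n (v : p.-tuple R) : {ffun 'I_p -> int} :=
  [ffun i => Num.floor (tnth v i * n.+1%:R)].
Let node n (z : {ffun 'I_p -> int}) : 'rV[R]_p := \row_i ((z i)%:~R / n.+1%:R).

Let measurable_grid n (z : {ffun 'I_p -> int}) :
  measurable [set v | grid n v = z].
Proof.
rewrite (_ : [set v | _] = \bigcap_(i in [set: 'I_p])
    ((fun v => tnth v i * n.+1%:R) @^-1` `[(z i)%:~R, (z i + 1)%:~R[)).
  apply: fin_bigcap_measurable => // i _; rewrite -[X in measurable X]setTI.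
  have : measurable_fun setT (fun v : p.-tuple R => tnth v i * n.+1%:R).
    by apply: measurable_funM => //; exact: measurable_tnth.
  by apply => //; exact: measurable_itv.
apply/seteqP; split => v /=.
  by move=> <- i _ /=; rewrite in_itv /= ffunE floor_itv.
move=> H; apply/ffunP => i; rewrite ffunE; apply: floor_def.
by have := H i I; rewrite /= in_itv.
Qed.

Let cvg_node_grid v : (fun n => node n (grid n v)) @ \oo --> tup2row v.
Proof.
apply/cvg_ballP => e e0.
near=> n; split => // i j; rewrite (ord1 i) !mxE ffunE /ball /=.
have n0 : 0 < n.+1%:R :> R by rewrite ltr0n.
have /andP[h1 h2] := floor_itv (tnth v j * n.+1%:R).
set z := Num.floor _ in h1 h2 *.
have ne : n.+1%:R^-1 < e by near: n; exact: (near_infty_natSinv_lt (PosNum e0)).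
have H1 : z%:~R / n.+1%:R <= tnth v j by rewrite ler_pdivrMr.
have H2 : tnth v j < z%:~R / n.+1%:R + n.+1%:R^-1.
  by rewrite -[X in _ + X]mul1r -mulrDl ltr_pdivlMr//; move: h2; rewrite intrD.
move: H1 H2 ne; set a := z%:~R / _; set c := n.+1%:R^-1 => H1 H2 ne.
have c0 : 0 <= c by rewrite invr_ge0.
rewrite ltr_norml; apply/andP; split; lra.
Unshelve. all: by end_near. Qed.

(* A continuous function is the pointwise limit of its values at the nodes of finer
   and finer grids, each of which takes countably many values. *)
Lemma measurable_continuous_tup2row (f : 'rV[R]_p -> R) :
  continuous f -> measurable_fun setT (f \o @tup2row R p).
Proof.
move=> cf; apply: (@measurable_fun_cvg _ _ _ _ (fun n v => f (node n (grid n v)))).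
  move=> n _ B mB; rewrite setTI.
  rewrite (_ : _ @^-1` _ = \bigcup_(z : {ffun 'I_p -> int})
     ([set v | grid n v = z] `&` [set v | B (f (node n z))])).
    apply: countable_bigcupT_measurable => // z; apply: measurableI.
      exact: measurable_grid.
    have [Bz|nBz] := pselect (B (f (node n z))).
      by rewrite (_ : [set v | _] = setT)//; apply/seteqP; split.
    by rewrite (_ : [set v | _] = set0)//; apply/seteqP; split.
  apply/seteqP; split => v /=; first by exists (grid n v).
  by move=> [z _ [/= -> ]].
by move=> v _; exact: (cvg_comp _ f (@cvg_node_grid v) (cf (tup2row v))).
Qed.

End ContinuousMeasurable.

(** * Normalized products of a prior with a density, compared with that density *)

Section Tilting.
Variables (R : realType) (p : nat).
Implicit Types (prior f g : 'rV[R]_p -> R).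

(** Bayes' formula with [g] as likelihood. The constant prior 1 is allowed, in which case [g] is
    merely normalized. *)
Definition tilted prior g (b : 'rV[R]_p) : R :=
  prior b * g b / fine (Rp_integral (fun c => (prior c * g c)%:E)).

Lemma Rp_integral_ge0 f : (forall b, 0 <= f b) ->
  (0 <= Rp_integral (fun b => (f b)%:E))%E.
Proof. by move=> f0; apply: iint_ge0 => v; rewrite lee_fin. Qed.

Lemma Rp_integralD f g : (forall b, 0 <= f b) -> (forall b, 0 <= g b) ->
  measurable_fun setT (f \o @tup2row R p) ->
  measurable_fun setT (g \o @tup2row R p) ->
  (Rp_integral (fun b => (f b + g b)%:E) =
   Rp_integral (fun b => (f b)%:E) + Rp_integral (fun b => (g b)%:E))%E.
Proof.
move=> f0 g0 mf mg; rewrite /Rp_integral -iintD.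
- by apply: eq_iint => v; rewrite EFinD.
- by move=> v; rewrite lee_fin.
- exact: measurable_tup_EFin.
- by move=> v; rewrite lee_fin.
- exact: measurable_tup_EFin.
Qed.

Lemma Rp_integralZl (c : R) f : 0 <= c -> (forall b, 0 <= f b) ->
  measurable_fun setT (f \o @tup2row R p) ->
  (Rp_integral (fun b => (c * f b)%:E) = c%:E * Rp_integral (fun b => (f b)%:E))%E.
Proof.
move=> c0 f0 mf; rewrite /Rp_integral -iintZl//.
- by move=> v; rewrite lee_fin.
- exact: measurable_tup_EFin.
Qed.

Lemma le_Rp_integral f g : (forall b, 0 <= f b) ->
  measurable_fun setT (f \o @tup2row R p) ->
  measurable_fun setT (g \o @tup2row R p) ->
  (forall b, f b <= g b) ->
  (Rp_integral (fun b => (f b)%:E) <= Rp_integral (fun b => (g b)%:E))%E.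
Proof.
move=> f0 mf mg fg; apply: le_iint.
- by move=> v; rewrite lee_fin.
- exact: measurable_tup_EFin.
- exact: measurable_tup_EFin.
- by move=> v; rewrite lee_fin.
Qed.

Lemma Rp_integral_sum (I : Type) (r : seq I) (f : I -> 'rV[R]_p -> R) :
  (forall i b, 0 <= f i b) ->
  (forall i, measurable_fun setT (f i \o @tup2row R p)) ->
  (Rp_integral (fun b => (\sum_(i <- r) f i b)%:E) =
   \sum_(i <- r) Rp_integral (fun b => (f i b)%:E))%E.
Proof.
move=> f0 mf; rewrite /Rp_integral -iint_sum.
- by apply: eq_iint => v; rewrite sumEFin.
- by move=> i v; rewrite lee_fin.
- by move=> i; apply: measurable_tup_EFin; exact: mf.
Qed.

Lemma Rp_integral_tilted prior g :
  (forall b, 0 <= prior b) -> (forall b, 0 <= g b) ->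
  measurable_fun setT (prior \o @tup2row R p) ->
  measurable_fun setT (g \o @tup2row R p) ->
  (0 < Rp_integral (fun b => (prior b * g b)%:E) < +oo)%E ->
  Rp_integral (fun b => (tilted prior g b)%:E) = 1%E.
Proof.
move=> pr0 g0 mpr mg /andP[Z0 Zy].
have Zfin : Rp_integral (fun b => (prior b * g b)%:E) \is a fin_num.
  by rewrite ge0_fin_numE// ltW.
have Zgt0 : 0 < fine (Rp_integral (fun b => (prior b * g b)%:E)).
  by rewrite -lte_fin fineK.
rewrite /tilted.
under [X in Rp_integral X]eq_fun do rewrite mulrC.
rewrite Rp_integralZl ?invr_ge0 ?(ltW Zgt0)//.
- by rewrite -[X in (_ * X)%E]fineK// -EFinM mulVf// gt_eqF.
- by move=> b; exact: mulr_ge0.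
- exact: measurable_funM.
Qed.

(** The normalizer [z] lies within [J] of [a], hence is at least [a / 2]. The positive part of the
    difference is at most [g (|prior - a| + J) / z], whose integral is at most
    [2 J / z <= 4 J / a]. *)
Lemma tv_dist_tilted_le prior g (a J : R) :
  (forall b, 0 <= prior b) -> (forall b, 0 <= g b) ->
  measurable_fun setT (prior \o @tup2row R p) ->
  measurable_fun setT (g \o @tup2row R p) ->
  Rp_integral (fun b => (g b)%:E) = 1%E -> 0 < a -> J <= a / 2 ->
  (Rp_integral (fun b => (g b * `|prior b - a|)%:E) <= J%:E)%E ->
  (tv_dist (tilted prior g) g <= (4 * J / a)%:E)%E.
Proof.
move=> pr0 g0 mpr mg g1 a0 Ja IJ.
set Z := Rp_integral (fun c => (prior c * g c)%:E).
have mprg : measurable_fun setT ((fun b => prior b * g b) \o @tup2row R p).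
  exact: measurable_funM.
have prg0 b : 0 <= prior b * g b by exact: mulr_ge0.
have mab : measurable_fun setT ((fun b => g b * `|prior b - a|) \o @tup2row R p).
  apply: measurable_funM => //; apply: measurableT_comp => //.
  exact: measurable_funB.
have ab0 b : 0 <= g b * `|prior b - a| by rewrite mulr_ge0.
have mag : measurable_fun setT ((fun b => a * g b) \o @tup2row R p).
  exact: measurable_funM.
have ag0 b : 0 <= a * g b by rewrite mulr_ge0// ltW.
have Zle : (Z <= (a + J)%:E)%E.
  apply: (@le_trans _ _ (Rp_integral (fun b => (a * g b + g b * `|prior b - a|)%:E))).
    apply: le_Rp_integral => //; first exact: measurable_funD.
    move=> b; rewrite [X in _ <= X + _]mulrC -mulrDr mulrC ler_wpM2l//.
    by have := ler_norm (prior b - a); lra.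
  rewrite Rp_integralD// Rp_integralZl ?(ltW a0)// g1 mule1 EFinD.
  by apply: leeD.
have Z0 : (0 <= Z)%E by exact: Rp_integral_ge0.
have Zfin : Z \is a fin_num by rewrite ge0_fin_numE// (le_lt_trans Zle) ?ltry.
(* The lower bound a - J <= Z, with [J] on the other side so that every integrand is nonnegative. *)
have Zge : (a%:E <= Z + J%:E)%E.
  apply: (@le_trans _ _ (Rp_integral (fun b => (prior b * g b + g b * `|prior b - a|)%:E))).
    rewrite -[X in (X <= _)%E]mule1 -g1 -Rp_integralZl ?(ltW a0)//.
    apply: le_Rp_integral => //; first exact: measurable_funD.
    move=> b; rewrite [X in _ <= X + _]mulrC -mulrDr mulrC ler_wpM2l//.
    by have := ler_norm (- (prior b - a)); rewrite normrN; lra.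
  by rewrite Rp_integralD//; apply: leeD.
pose z := fine Z.
have ZE : Z = z%:E by rewrite fineK.
have zle : z <= a + J by rewrite -lee_fin -ZE.
have zge : a <= z + J by rewrite -lee_fin EFinD -ZE.
have z0 : 0 < z by lra.
have J0 : 0 <= J by rewrite -lee_fin (le_trans _ IJ)// Rp_integral_ge0.
have tE b : tilted prior g b = z^-1 * (prior b * g b) by rewrite /tilted -/Z -/z mulrC.
have mt : measurable_fun setT (tilted prior g \o @tup2row R p).
  by apply: measurable_funM => //.
rewrite tv_dist_pos_part//; last 2 first.
- by move=> b; rewrite tE mulr_ge0// invr_ge0 ltW.
- by apply: Rp_integral_tilted => //; rewrite -/Z ZE ltry lte_fin z0.
have mJg : measurable_fun setT ((fun b => J * g b) \o @tup2row R p).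
  exact: measurable_funM.
have Jg0 b : 0 <= J * g b by rewrite mulr_ge0.
apply: (@le_trans _ _ (Rp_integral
   (fun b => (z^-1 * (g b * `|prior b - a| + J * g b))%:E))).
  apply: le_Rp_integral.
  - by move=> b; rewrite le_max lexx orbT.
  - by apply: measurable_maxr => //; exact: measurable_funB.
  - by apply: measurable_funM => //; exact: measurable_funD.
  - move=> b; rewrite ge_max mulr_ge0 ?invr_ge0 ?(ltW z0) ?addr_ge0// andbT tE.
    have -> : z^-1 * (prior b * g b) - g b = z^-1 * (g b * (prior b - z)).
      by rewrite mulrBr mulrBr mulrC [g b * z]mulrC mulKf ?gt_eqF//
        [z^-1 * _]mulrC [prior b * _]mulrC.
    rewrite ler_wpM2l ?invr_ge0 ?(ltW z0)// [J * _]mulrC -mulrDr ler_wpM2l//.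
    by have := ler_norm (prior b - a); lra.
rewrite Rp_integralZl ?invr_ge0 ?(ltW z0)//; last 2 first.
- by move=> b; exact: addr_ge0.
- exact: measurable_funD.
rewrite Rp_integralD// [X in (_ + X)%E]Rp_integralZl// g1 mule1.
apply: (@le_trans _ _ (z^-1%:E * (J%:E + J%:E))%E).
  by apply: lee_wpmul2l; [rewrite lee_fin invr_ge0 ltW|apply: leeD].
rewrite -EFinD -EFinM lee_fin mulrC ler_pdivrMr// mulrAC ler_pdivlMr//.
by rewrite -[4]/(4%:R : R); nra.
Qed.

End Tilting.

(** * The tilted density is close to a Gaussian product concentrated near the true coefficient *)

Section Concentration.
Variables (R : realType) (p : nat).
Implicit Types (prior : 'rV[R]_p -> R) (beta : 'rV[R]_p).

(** Continuity handles the points within [delta] of [beta]. Elsewhere some coordinate is off by at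
    least [delta], so one of its two exponentials is at least exp(l delta); this cancels exp(- l
    delta) and leaves [2 K], a bound on the difference of two prior values. [delta] is fixed before
    [l], which stays free to be taken large. *)
Lemma continuous_exp_majorant prior beta (K eta : R) :
  continuous prior -> (forall b, `|prior b| <= K) -> 0 < eta ->
  exists2 delta, 0 < delta & forall l b, 0 <= l ->
    `|prior b - prior beta| <= eta + \sum_k K *+ 2 * expR (- (l * delta)) *
      (expR (l * (b ord0 k - beta ord0 k)) + expR (- l * (b ord0 k - beta ord0 k))).
Proof.
move=> cpr bpr eta0.
have K0 : 0 <= K by exact: le_trans (normr_ge0 _) (bpr beta).
have /cvgrPdist_le /(_ _ eta0) := cpr beta.
rewrite near_nbhs => /nbhs_ballP[delta /= delta0 Hd].
exists delta => // l b l0.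
have t0 k : 0 <= K *+ 2 * expR (- (l * delta)) *
   (expR (l * (b ord0 k - beta ord0 k)) + expR (- l * (b ord0 k - beta ord0 k))).
  by rewrite mulr_ge0 ?addr_ge0 ?expR_ge0// mulr_ge0 ?expR_ge0// mulrn_wge0.
have [near_b|] := pselect (forall k, `|beta ord0 k - b ord0 k| < delta).
  rewrite distrC; apply: (le_trans (Hd b _)); last by rewrite lerDl sumr_ge0.
  by split => // i k; rewrite (ord1 i); exact: near_b.
move=> /existsNP[k /negP]; rewrite -leNgt => far.
rewrite (bigD1 k)//= addrCA; apply: (@le_trans _ _ (K *+ 2)).
  by rewrite mulr2n (le_trans (ler_normB _ _))// lerD.
rewrite ler_wpDr ?addr_ge0 ?sumr_ge0 ?(ltW eta0)//.
rewrite -mulrA ler_peMr ?mulrn_wge0// mulrDr -!expRD.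
have [bk|bk] := leP (beta ord0 k) (b ord0 k).
  rewrite ler_wpDr ?expR_ge0// -expR0 ler_expR addrC -mulrBr mulr_ge0//.
  by move: far; rewrite distrC ger0_norm; lra.
rewrite ler_wpDl ?expR_ge0// -expR0 ler_expR mulNr -opprD -mulrDr oppr_ge0.
rewrite mulr_ge0_le0//.
by move: far; rewrite gtr0_norm; lra.
Qed.

(** [delta] and [V] depend only on the prior, [beta] and [eps], and serve all means and scales at
    once. The probabilistic part then only has to make the random means and variances satisfy these
    bounds. *)
Lemma tv_dist_tilted_gauss_prod prior beta (eps : R) :
  continuous prior -> (exists K : R, forall b, `|prior b| <= K) ->
  (forall b, 0 <= prior b) -> 0 < prior beta -> 0 < eps ->
  exists delta V : R, [/\ 0 < delta, 0 < V &
    forall mu s : 'I_p -> R, (forall k, s k != 0) -> (forall k, s k ^+ 2 <= V) ->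
    (forall k, `|mu k - beta ord0 k| <= delta) ->
    (tv_dist (tilted prior (gauss_prod mu s)) (gauss_prod mu s) <= eps%:E)%E].
Proof.
move=> cpr [K bpr] pr0 prb0 eps0; set a := prior beta in prb0 *.
have K0 : 0 <= K by exact: le_trans (normr_ge0 _) (bpr beta).
(* The first bound is the condition of [tv_dist_tilted_le]; the second turns its conclusion
   [4 * J / a] into [eps]. *)
pose J := Num.min (a / 2) (eps * a / 4).
have J0 : 0 < J by rewrite lt_min !divr_gt0// mulr_gt0.
have J20 : 0 < J / 2 by rewrite divr_gt0.
have [delta d0 maj] := continuous_exp_majorant beta cpr bpr J20.
(* The exponential terms will sum to at most C exp(-x). Since exp x >= 1 + x, the choice x = 2C/J
   brings this below J/2; the other half of [J] goes to the error near [beta]. *)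
pose C : R := p%:R * (K *+ 4 * expR (2^-1)).
have C0 : 0 <= C by rewrite !mulr_ge0 ?expR_ge0// mulrn_wge0.
pose x := 2 * C / J.
have x0 : 0 <= x by apply: divr_ge0; [exact: mulr_ge0|exact: ltW].
pose l := 2 * x / delta.
have l0 : 0 <= l by apply: divr_ge0; [exact: mulr_ge0|exact: ltW].
have lld : l * delta = 2 * x by rewrite /l divfK// gt_eqF.
(* A mean off by at most delta/2 costs a factor exp(l delta / 2) = exp x, against the available
   exp(- l delta) = exp(-2x). The variance bound keeps l^2 s^2 / 2 below 1/2, and the added 1 covers
   l = 0. *)
exists (delta / 2), (1 + l ^+ 2)^-1.
have l2 : 0 < 1 + l ^+ 2 by rewrite ltr_pwDl// sqr_ge0.
split; [by rewrite divr_gt0|by rewrite invr_gt0|move=> mu s s0 sV mub].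
have mpr := measurable_continuous_tup2row cpr.
have mg := measurable_gauss_prod mu s.
have g0 := gauss_prod_ge0 mu s.
apply: (@le_trans _ _ (4 * J / a)%:E); last first.
  rewrite lee_fin ler_pdivrMr//; have : J <= eps * a / 4 by rewrite ge_min lexx orbT.
  lra.
apply: tv_dist_tilted_le => //.
- exact: Rp_integral_gauss_prod.
- by rewrite ge_min lexx.
pose c : R := K *+ 2 * expR (- (l * delta)).
have c0 : 0 <= c by rewrite mulr_ge0 ?expR_ge0// mulrn_wge0.
pose E k (t : R) b := gauss_prod mu s b * expR (t * (b ord0 k - beta ord0 k)).
have E0 k t b : 0 <= E k t b by rewrite mulr_ge0 ?expR_ge0.
have mE k t : measurable_fun setT (E k t \o @tup2row R p).
  apply: measurable_funM => //; apply: measurableT_comp => //.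
  apply: measurable_funM => //; apply: measurable_funB => //.
  exact: measurable_tup2row_coord.
have cEE0 k b : 0 <= c * (E k l b + E k (- l) b) by rewrite mulr_ge0 ?addr_ge0.
have mcEE k : measurable_fun setT ((fun b => c * (E k l b + E k (- l) b)) \o @tup2row R p).
  by apply: measurable_funM => //; apply: measurable_funD; exact: mE.
apply: (@le_trans _ _ (Rp_integral (fun b =>
  (J / 2 * gauss_prod mu s b + \sum_k c * (E k l b + E k (- l) b))%:E))).
  apply: le_Rp_integral.
  - by move=> b; rewrite mulr_ge0.
  - apply: measurable_funM => //; apply: measurableT_comp => //.
    exact: measurable_funB.
  - apply: measurable_funD; first exact: measurable_funM.
    by apply: measurable_sum => k; exact: mcEE.
  - move=> b; apply: (le_trans (ler_wpM2l (g0 b) (maj l b l0))).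
    rewrite mulrDr mulrC lerD2l mulr_sumr ler_sum// => k _.
    by rewrite -/c mulrCA /E -mulrDr.
rewrite Rp_integralD//; first last.
- by apply: measurable_sum => k; exact: mcEE.
- exact: measurable_funM.
- by move=> b; rewrite sumr_ge0.
- by move=> b; rewrite mulr_ge0// ltW.
rewrite Rp_integralZl ?(ltW J20)// Rp_integral_gauss_prod mule1.
rewrite Rp_integral_sum//.
have term k : (Rp_integral (fun b => (c * (E k l b + E k (- l) b))%:E) <=
   (K *+ 4 * expR (2^-1) * expR (- x))%:E)%E.
  rewrite Rp_integralZl//; last 2 first.
  - by move=> b; rewrite addr_ge0.
  - by apply: measurable_funD; exact: mE.
  rewrite Rp_integralD// !Rp_integral_gauss_prod_exp// -EFinD -EFinM lee_fin.
  have -> : K *+ 4 * expR 2^-1 * expR (- x) =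
      c * (expR (l * (delta / 2) + 2^-1) + expR (l * (delta / 2) + 2^-1)).
    rewrite /c mulrA lld (_ : 2 * x / 2 = x); last by field.
    rewrite -mulr2n -[in RHS]mulrA mulrnAr -expRD (_ : - (2 * x) + (x + 2^-1) = 2^-1 - x).
      by rewrite -mulrA -expRD; ring.
    by ring.
  have sl : l ^+ 2 * s k ^+ 2 / 2 <= 2^-1.
    rewrite -[leRHS]mul1r ler_pM2r ?invr_gt0//.
    apply: (@le_trans _ _ (l ^+ 2 * (1 + l ^+ 2)^-1)).
      by rewrite ler_wpM2l ?sqr_ge0.
    by rewrite ler_pdivrMr// mul1r lerDr.
  have := mub k; rewrite ler_norml => /andP[m1 m2].
  rewrite ler_wpM2l// lerD// ler_expR lerD// ?sqrrN//.
    by rewrite ler_wpM2l.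
  by rewrite mulNr -mulrN ler_wpM2l//; lra.
apply: (@le_trans _ _ ((J / 2)%:E + \sum_(k < p) (K *+ 4 * expR (2^-1) * expR (- x))%:E)%E).
  by apply: leeD => //; apply: lee_sum => k _; exact: term.
rewrite sumEFin -EFinD lee_fin sumr_const card_ord -[X in _ + X]mulr_natl
  [X in _ + X]mulrA -/C.
have xp : 0 < 1 + x by rewrite ltr_pwDl.
suff : C * expR (- x) <= J / 2 by lra.
rewrite expRN ler_pdivrMr ?expR_gt0//.
apply: (@le_trans _ _ (J / 2 * (1 + x))); last first.
  by rewrite ler_wpM2l ?(ltW J20)// expR_ge1Dx.
rewrite mulrDr mulr1 /x.
have -> : J / 2 * (2 * C / J) = C by field; rewrite gt_eqF.
by rewrite lerDr ltW.
Qed.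

End Concentration.

(** * Gram matrix, least squares and likelihood for covariates in the standard basis *)

Section OneHotDesign.
Variables (R : realType) (m p : nat) (x : 'I_m -> 'I_p) (y : 'cV[R]_m).

Definition onehot : 'M[R]_(m, p) := \matrix_(j, k) (x j == k)%:R.
Definition arm_count (k : 'I_p) : R := \sum_(j < m) (x j == k)%:R.
Definition arm_sum (k : 'I_p) : R := \sum_(j < m) (x j == k)%:R * y j ord0.
Definition arm_mean (k : 'I_p) : R := arm_sum k / arm_count k.

Lemma arm_count_ge0 k : 0 <= arm_count k.
Proof. by apply: sumr_ge0 => j _; rewrite ler0n. Qed.

Lemma onehot_gram : onehot^T *m onehot = diag_mx (\row_k arm_count k).
Proof.
apply/matrixP => i k; rewrite !mxE.
under eq_bigr do rewrite !mxE.
have [->|ik] := eqVneq i k; rewrite ?mulr1n ?mulr0n.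
  by apply: eq_bigr => j _; case: (x j == k); rewrite ?mulr1 ?mulr0.
rewrite big1// => j _; have [xi|] := eqVneq (x j) i; last by rewrite mul0r.
by rewrite xi (negbTE ik) mulr0.
Qed.

Lemma onehot_gram_unit :
  (onehot^T *m onehot \in unitmx) = [forall k, 0 < arm_count k].
Proof.
rewrite onehot_gram unitmxE det_diag unitfE.
apply/prodf_neq0/forallP => [h k|h k _].
  by have := h k isT; rewrite mxE lt0r arm_count_ge0 => ->.
by rewrite mxE gt_eqF.
Qed.

Lemma lambda_min_onehot_gram k : lambda_min (onehot^T *m onehot) <= arm_count k.
Proof.
rewrite onehot_gram; apply: ge_inf.
  (* [inf] is a genuine lower bound only for a set bounded below. Here 0 is one, because every
     eigenvalue equals some arm count: compare a nonzero coordinate of an eigenvector. *)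
  exists 0 => a /eigenvalueP[v hv v0].
  have /rV0Pn[i vi0] := v0.
  move: hv => /rowP/(_ i); rewrite mul_mx_diag !mxE [RHS]mulrC => /mulfI.
  by move=> /(_ vi0) <-; exact: arm_count_ge0.
apply/eigenvalueP; exists (delta_mx 0 k).
  apply/rowP => i; rewrite mul_mx_diag !mxE /=.
  by case: eqP => [->|_]; rewrite ?mul1r ?mulr1 ?mul0r ?mulr0.
by apply/rV0Pn; exists k; rewrite mxE !eqxx oner_eq0.
Qed.

Hypothesis count_gt0 : forall k, 0 < arm_count k.

Lemma invmx_onehot_gram :
  invmx (onehot^T *m onehot) = diag_mx (\row_k (arm_count k)^-1).
Proof.
have Gu : onehot^T *m onehot \in unitmx by rewrite onehot_gram_unit; exact/forallP.
rewrite -[RHS](mulKmx Gu) onehot_gram mulmx_diag.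
rewrite (_ : \row_j _ = const_mx 1); first by rewrite diag_const_mx mulmx1.
by apply/rowP => k; rewrite !mxE divff// gt_eqF.
Qed.

Lemma ols_onehot k :
  (invmx (onehot^T *m onehot) *m onehot^T *m y)^T ord0 k = arm_mean k.
Proof.
rewrite mxE -mulmxA invmx_onehot_gram mul_diag_mx !mxE mulrC; congr (_ / _).
by apply: eq_bigr => j _; rewrite !mxE.
Qed.

Lemma gauss_density_diag (mu s b : 'rV[R]_p) : (forall k, 0 < s ord0 k) ->
  gauss_density mu (diag_mx (\row_k s ord0 k ^+ 2)) b =
  gauss_prod (fun k => mu ord0 k) (fun k => s ord0 k) b.
Proof.
move=> s0; rewrite /gauss_density /gauss_prod.
have inv : invmx (diag_mx (\row_k s ord0 k ^+ 2)) = diag_mx (\row_k s ord0 k ^- 2).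
  have Du : diag_mx (\row_k s ord0 k ^+ 2) \in unitmx.
    rewrite unitmxE det_diag unitfE; apply/prodf_neq0 => k _.
    by rewrite mxE expf_neq0// gt_eqF.
  rewrite -[RHS](mulKmx Du) mulmx_diag.
  rewrite (_ : \row_j (_ * _) = const_mx 1); first by rewrite diag_const_mx mulmx1.
  by apply/rowP => k; rewrite !mxE divff// expf_neq0// gt_eqF.
rewrite inv det_diag.
have -> : \prod_i (\row_k s ord0 k ^+ 2) ord0 i = (\prod_i s ord0 i) ^+ 2.
  by rewrite -prodrXl; apply: eq_bigr => i _; rewrite mxE.
rewrite sqrtr_sqr ger0_norm; last by apply: prodr_ge0 => i _; exact: ltW.
under [RHS]eq_bigr do rewrite normal_pdfE ?gt_eqF//=.
rewrite big_split /=; congr (_ * _).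
  rewrite (_ : _ ^- p = \prod_(i < p) (Num.sqrt (pi *+ 2))^-1); last first.
    by rewrite prodr_const card_ord exprVn.
  rewrite -prodfV -big_split /=.
  apply: eq_bigr => i _; rewrite /normal_peak -mulrnAr sqrtrM ?sqr_ge0//.
  by rewrite sqrtr_sqr gtr0_norm// invfM mulrC.
rewrite /normal_fun -expR_sum; congr expR.
rewrite mxE mul_mx_diag -sumrN mulr_suml; apply: eq_bigr => i _.
rewrite !mxE; field.
by rewrite gt_eqF.
Qed.

Variable sigma : R.
Hypothesis sigma0 : 0 < sigma.

Definition arm_sd (k : 'I_p) : R := sigma / Num.sqrt (arm_count k).

Lemma arm_sd_gt0 k : 0 < arm_sd k.
Proof. by rewrite divr_gt0// sqrtr_gt0. Qed.

Lemma sqr_arm_sd k : arm_sd k ^+ 2 = sigma ^+ 2 / arm_count k.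
Proof. by rewrite /arm_sd exprMn exprVn sqr_sqrtr ?arm_count_ge0. Qed.

Lemma gauss_density_onehot b :
  gauss_density (invmx (onehot^T *m onehot) *m onehot^T *m y)^T
    (sigma ^+ 2 *: invmx (onehot^T *m onehot)) b = gauss_prod arm_mean arm_sd b.
Proof.
have -> : sigma ^+ 2 *: invmx (onehot^T *m onehot) =
    diag_mx (\row_k (\row_k arm_sd k) ord0 k ^+ 2).
  rewrite invmx_onehot_gram -linearZ /=; congr diag_mx; apply/rowP => k.
  by rewrite !mxE sqr_arm_sd.
rewrite gauss_density_diag; last by move=> k; rewrite mxE arm_sd_gt0.
by apply: eq_bigr => k _; rewrite ols_onehot mxE.
Qed.

(** Completing the square arm by arm: as a function of [b] the likelihood is a Gaussian centred at
    the arm means. [C] collects what is free of [b], namely the residual sum of squares [rest] and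
    the normal peaks. *)
Lemma likelihood_onehot : exists2 C : R, 0 < C &
  forall b, likelihood sigma onehot y b = C * gauss_prod arm_mean arm_sd b.
Proof.
pose Q k := \sum_(j < m) (x j == k)%:R * y j ord0 ^+ 2.
pose rest := \sum_k (Q k - arm_sum k ^+ 2 / arm_count k).
exists (expR (- rest / (sigma ^+ 2 *+ 2)) / \prod_k normal_peak (arm_sd k)).
  rewrite divr_gt0 ?expR_gt0//; apply: prodr_gt0 => k _.
  by rewrite normal_peak_gt0// gt_eqF// arm_sd_gt0.
move=> b; rewrite /gauss_prod.
under [X in _ = _ * X]eq_bigr do rewrite normal_pdfE ?gt_eqF ?arm_sd_gt0//=.
rewrite big_split /= mulrA divfK; last first.
  rewrite gt_eqF//; apply: prodr_gt0 => k _.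
  by rewrite normal_peak_gt0// gt_eqF// arm_sd_gt0.
rewrite /likelihood /normal_fun -!expR_sum -expRD; congr expR.
have rowE (j : 'I_m) : (row j onehot *m b^T) ord0 ord0 = b ord0 (x j).
  rewrite mxE (bigD1 (x j))//= !mxE eqxx mul1r big1 ?addr0// => k kx.
  by rewrite !mxE eq_sym (negbTE kx) mul0r.
(* Regroups the observations by arm and expands each square, so that only the count, the sum and the
   sum of squares of each arm remain. *)
have sumE : \sum_(j < m) (y j ord0 - b ord0 (x j)) ^+ 2 =
    \sum_k (Q k - 2 * b ord0 k * arm_sum k + b ord0 k ^+ 2 * arm_count k).
  transitivity (\sum_k \sum_(j < m) (x j == k)%:R * (y j ord0 - b ord0 k) ^+ 2).
    rewrite exchange_big /=; apply: eq_bigr => j _.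
    rewrite (bigD1 (x j))//= eqxx mul1r big1 ?addr0// => k kx.
    by rewrite eq_sym (negbTE kx) mul0r.
  apply: eq_bigr => k _; rewrite /Q /arm_sum /arm_count !mulr_sumr.
  rewrite -sumrB -big_split /=; apply: eq_bigr => j _; ring.
under eq_bigr do rewrite rowE.
rewrite -mulr_suml sumrN sumE /rest -!sumrN !mulr_suml -big_split /=.
apply: eq_bigr => k _; rewrite sqr_arm_sd /arm_mean; field.
by rewrite !gt_eqF.
Qed.

End OneHotDesign.

(** * Normalizing constants and measurability of the total variation event *)

Section TiltedMeasurability.
Variables (R : realType) (p : nat).
Implicit Types (prior g : 'rV[R]_p -> R).

Lemma gauss_prod_gt0 (mu s : 'I_p -> R) b :
  (forall k, s k != 0) -> 0 < gauss_prod mu s b.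
Proof.
move=> s0; apply: prodr_gt0 => k _; rewrite normal_pdfE//.
by rewrite mulr_gt0 ?expR_gt0// normal_peak_gt0.
Qed.

(** As [g] is positive, a zero normalizer would force the prior to have zero mass; the upper bound
    is [K] times the mass of [g]. *)
Lemma tilted_normalizer prior g (K : R) :
  (forall b, `|prior b| <= K) -> (forall b, 0 <= prior b) -> (forall b, 0 < g b) ->
  measurable_fun setT (prior \o @tup2row R p) ->
  measurable_fun setT (g \o @tup2row R p) ->
  Rp_integral (fun b => (prior b)%:E) = 1%E ->
  (Rp_integral (fun b => (g b)%:E) < +oo)%E ->
  (0 < Rp_integral (fun b => (prior b * g b)%:E) < +oo)%E.
Proof.
move=> bpr pr0 g0 mpr mg pr1 gy.
have K0 : 0 <= K by exact: le_trans (normr_ge0 _) (bpr 0).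
have prg0 b : 0 <= prior b * g b by rewrite mulr_ge0// ltW.
apply/andP; split.
  rewrite lt0e Rp_integral_ge0// andbT; apply/eqP => Z0.
  suff : Rp_integral (fun b => (prior b)%:E) = 0%E.
    by rewrite pr1 => /eqP; rewrite onee_eq0.
  apply: (@iint_mul_eq0 _ _ _ (g \o @tup2row R p)) => //.
  - by move=> v; rewrite lee_fin.
  - exact: measurable_tup_EFin.
  - by move=> v; exact: g0.
  - by rewrite -[RHS]Z0; apply: eq_iint => v; rewrite -EFinM mulrC.
apply: (@le_lt_trans _ _ (Rp_integral (fun b => (K * g b)%:E))).
  apply: le_Rp_integral => //; [exact: measurable_funM|exact: measurable_funM|].
  by move=> b; rewrite ler_wpM2r ?(ltW (g0 _))// (le_trans (ler_norm _)).
rewrite Rp_integralZl//; last by move=> b; exact: ltW.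
by rewrite lte_mul_pinfty// ?lee_fin.
Qed.

Lemma tiltedZ prior g (C : R) : 0 < C ->
  (forall b, 0 <= prior b) -> (forall b, 0 <= g b) ->
  measurable_fun setT (prior \o @tup2row R p) ->
  measurable_fun setT (g \o @tup2row R p) ->
  (Rp_integral (fun b => (prior b * g b)%:E) < +oo)%E ->
  tilted prior (fun b => C * g b) = tilted prior g.
Proof.
move=> C0 pr0 g0 mpr mg Zy; apply/funext => b; rewrite /tilted.
have prg0 c : 0 <= prior c * g c by exact: mulr_ge0.
under [X in Rp_integral X]eq_fun do rewrite mulrCA.
rewrite Rp_integralZl ?(ltW C0)//; last exact: measurable_funM.
rewrite fineM//; last by rewrite ge0_fin_numE// Rp_integral_ge0.
by rewrite mulrCA /= -mulf_div divff ?mul1r// gt_eqF.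
Qed.

Lemma tilted1 g : Rp_integral (fun b => (g b)%:E) = 1%E -> tilted (fun=> 1) g = g.
Proof.
move=> g1; apply/funext => b; rewrite /tilted.
under [X in Rp_integral X]eq_fun do rewrite mul1r.
by rewrite g1 /= divr1 mul1r.
Qed.

(** On [D] both normalizers are positive and finite, so Scheffe's formula applies and the distance
    is a parametric integral of the single function [F]. Intersecting with [D] discards the points
    where a normalizer may degenerate. *)
Lemma measurable_tv_dist_tilted d (T : measurableType d) (D : set T)
    (L : T -> 'rV[R]_p -> R) prior (eps : R) :
  measurable D -> (forall w b, 0 < L w b) -> (forall b, 0 <= prior b) ->
  measurable_fun setT (fun z : T * p.-tuple R => L z.1 (tup2row z.2)) ->
  measurable_fun setT (prior \o @tup2row R p) ->
  (forall w, D w -> 0 < Rp_integral (fun b => (prior b * L w b)%:E) < +oo)%E ->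
  (forall w, D w -> 0 < Rp_integral (fun b => (L w b)%:E) < +oo)%E ->
  measurable (D `&`
    [set w | (eps%:E < tv_dist (tilted prior (L w)) (tilted (fun=> 1%R) (L w)))%E]).
Proof.
move=> mD L0 pr0 mL mpr Dpr D1'.
have D1 w : D w -> (0 < Rp_integral (fun b => (1 * L w b)%R%:E) < +oo)%E.
  by move=> /D1'; under [X in Rp_integral X]eq_fun do rewrite -(mul1r (L w _)).
pose z (h : 'rV[R]_p -> R) w := fine (Rp_integral (fun b => (h b * L w b)%:E)).
(* Division by a normalizer is written as multiplication by exp(- ln z), a composition of measurable
   functions that equals 1/z wherever z > 0, in particular on [D]. *)
pose F (zw : T * p.-tuple R) : R :=
  let b := tup2row zw.2 in
  Num.max (prior b * L zw.1 b * expR (- ln (z prior zw.1))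
           - 1 * L zw.1 b * expR (- ln (z (fun=> 1) zw.1))) 0.
have mh (h : 'rV[R]_p -> R) : measurable_fun setT (h \o @tup2row R p) ->
    measurable_fun setT (fun zw : T * p.-tuple R => h (tup2row zw.2) * L zw.1 (tup2row zw.2)).
  move=> mh; apply: measurable_funM => //.
  exact: (measurableT_comp mh measurable_snd).
have mz (h : 'rV[R]_p -> R) : (forall b, 0 <= h b) ->
    measurable_fun setT (h \o @tup2row R p) -> measurable_fun setT (z h).
  move=> h0 mh'; apply: measurableT_comp => //.
  apply: (@measurable_iint R _ T p (fun zw => (h (tup2row zw.2) * L zw.1 (tup2row zw.2))%:E)).
    by move=> zw; rewrite lee_fin mulr_ge0// ltW.
  by apply/measurable_EFinP; exact: mh.
have mterm (h : 'rV[R]_p -> R) : (forall b, 0 <= h b) ->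
    measurable_fun setT (h \o @tup2row R p) ->
    measurable_fun setT (fun zw : T * p.-tuple R =>
      h (tup2row zw.2) * L zw.1 (tup2row zw.2) * expR (- ln (z h zw.1))).
  move=> h0 mh'; apply: measurable_funM; first exact: mh.
  apply: measurableT_comp => //; apply: measurableT_comp => //.
  apply: measurableT_comp; first exact: measurable_ln.
  exact: (measurableT_comp (mz h h0 mh') measurable_fst).
have mF : measurable_fun setT F.
  apply: measurable_maxr => //; apply: measurable_funB; first exact: mterm.
  by apply: (mterm (fun=> 1)) => [b|]; [exact: ler01|exact: measurable_cst].
have mI : measurable_fun setT (fun w => iint (fun v => (F (w, v))%:E)).
  apply: (@measurable_iint R _ T p (fun zw => (F zw)%:E)).
    by move=> zw; rewrite lee_fin le_max lexx orbT.
  exact/measurable_EFinP.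
rewrite (_ : _ `&` _ = D `&` [set w | (eps%:E < iint (fun v => (F (w, v))%:E))%E]).
  by apply: emeasurable_fun_o_infty => //; exact: measurable_funTS.
apply/seteqP.
suff H w : D w -> tv_dist (tilted prior (L w)) (tilted (fun=> 1) (L w)) =
    iint (fun v => (F (w, v))%:E).
  by split=> w /= [Dw]; rewrite H.
move=> Dw.
have mLw : measurable_fun setT (L w \o @tup2row R p).
  exact: (measurableT_comp mL (@pair1_measurable _ _ T (p.-tuple R) w)).
have zgt0 (h : 'rV[R]_p -> R) :
    (0 < Rp_integral (fun b => (h b * L w b)%:E) < +oo)%E -> 0 < z h w.
  by move=> /andP[h0 hy]; rewrite fine_gt0// h0.
have tE (h : 'rV[R]_p -> R) b :
    (0 < Rp_integral (fun b => (h b * L w b)%:E) < +oo)%E ->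
    tilted h (L w) b = h b * L w b * expR (- ln (z h w)).
  by move=> h0; rewrite expRN lnK// posrE zgt0.
have t0 (h : 'rV[R]_p -> R) b : (forall b, 0 <= h b) ->
    (0 < Rp_integral (fun b => (h b * L w b)%:E) < +oo)%E -> 0 <= tilted h (L w) b.
  by move=> h0 hz; rewrite tE// !mulr_ge0 ?expR_ge0// ltW.
rewrite tv_dist_pos_part.
- by apply: eq_iint => v; rewrite !tE; [|exact: D1|exact: Dpr].
- by move=> b; apply: t0 => //; exact: Dpr.
- by move=> b; apply: t0 => //; exact: D1.
- by apply: measurable_funM => //; exact: measurable_funM.
- by apply: measurable_funM => //; exact: measurable_funM.
- by apply: Rp_integral_tilted => //; [move=> b; exact: ltW|exact: Dpr].
- by apply: Rp_integral_tilted => //; [move=> b; exact: ltW|exact: measurable_cst|exact: D1].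
Qed.

End TiltedMeasurability.

(** * From identities on events to identities for nonnegative weights *)

Section LayerCake.
Context d (T : measurableType d) (R : realType).
Local Open Scope ereal_scope.

(** Writes W(x) as the length of [0, W(x)[ and exchanges the integrals by Tonelli. The right-hand
    side involves [F] only through its integrals over superlevel sets of [W]. *)
Lemma layer_cake (mu : {sigma_finite_measure set T -> \bar R})
    (W : T -> R) (F : T -> \bar R) :
  (forall x, 0 <= W x)%R -> measurable_fun setT W ->
  (forall x, 0 <= F x) -> measurable_fun setT F ->
  \int[mu]_x ((W x)%:E * F x) =
  \int[lebesgue_measure]_t \int[mu]_(x in [set x | (0 <= t < W x)%R]) F x.
Proof.
move=> W0 mW F0 mF.
pose A : set (T * R) := [set z | (0 <= z.2 < W z.1)%R].
have mA : measurable A.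
  have mWz : measurable_fun setT (fun z : T * R => W z.1).
    exact: (measurableT_comp mW measurable_fst).
  have /(_ measurableT [set true]) : measurable_fun setT
      (fun z : T * R => (0 <= z.2)%R && (z.2 < W z.1)%R).
    apply: measurable_and; first exact: measurable_fun_ler.
    exact: measurable_fun_ltr.
  by rewrite setTI; apply.
pose f z : \bar R := (\1_A z)%:E * F z.1.
have f0 z : 0 <= f z by rewrite mule_ge0// lee_fin indicE.
have mf : measurable_fun setT f.
  apply: emeasurable_funM; first exact/measurable_EFinP/measurable_indic.
  exact: (measurableT_comp mF measurable_fst).
transitivity (\int[mu]_x \int[lebesgue_measure]_t f (x, t)).
  apply: eq_integral => x _; rewrite /f /=.
  under eq_integral do rewrite muleC.
  rewrite ge0_integralZl//=; first last.
  - apply/measurable_EFinP; apply: measurableT_comp; last exact: pair1_measurable.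
    exact: measurable_indic.
  rewrite muleC; congr (_ * _).
  have -> : (fun t => (\1_A (x, t))%:E) =
      (fun t : R => (\1_(`[0%R, W x[%classic) t)%:E : \bar R).
    apply/funext => t; rewrite !indicE.
    rewrite (_ : ((x, t) \in A) = (t \in `[0%R, W x[%classic))//.
  rewrite integral_indic//= setIT lebesgue_measure_itv/= lte_fin.
  have [_|W00] := ltP 0%R (W x); first by rewrite sube0.
  by congr EFin; apply/eqP; rewrite eq_le W0 W00.
rewrite (@fubini_tonelli _ _ _ _ R mu lebesgue_measure f mf f0).
apply: eq_integral => t _.
rewrite [RHS]integral_mkcond; apply: eq_integral => x _.
rewrite /f /patch indicE /= (_ : ((x, t) \in A) = (x \in [set x | (0 <= t < W x)%R])).
  by case: ifP => _; rewrite ?mul1e ?mul0e.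
by apply/idP/idP; rewrite !inE.
Qed.

(** The defining property of conditional expectation, extended from events to nonnegative weights:
    the superlevel sets of [W] belong to the sub-sigma-algebra, so both layer-cake integrands
    agree. *)
Lemma eq_integral_subsigma (mu : {sigma_finite_measure set T -> \bar R})
    (G : set (set T)) (F1 F2 : T -> \bar R) (W : T -> R) :
  (forall x, 0 <= F1 x) -> measurable_fun setT F1 ->
  (forall x, 0 <= F2 x) -> measurable_fun setT F2 ->
  (forall x, 0 <= W x)%R -> measurable_fun setT W ->
  (forall B : set R, measurable B -> <<s G >> (W @^-1` B)) ->
  (forall A, <<s G >> A -> \int[mu]_(x in A) F1 x = \int[mu]_(x in A) F2 x) ->
  \int[mu]_x ((W x)%:E * F1 x) = \int[mu]_x ((W x)%:E * F2 x).
Proof.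
move=> F10 mF1 F20 mF2 W0 mW GW GF; rewrite !layer_cake//.
apply: eq_integral => t _; apply: GF.
have [t0|t0] := leP 0%R t.
  rewrite (_ : [set x | _] = W @^-1` `]t, +oo[); first exact: GW.
  by apply/seteqP; split=> x /=; rewrite in_itv /= andbT.
(* For t < 0 the layer is empty, and is still the preimage of a measurable set. *)
rewrite (_ : [set x | _] = W @^-1` set0); first exact: GW.
by apply/seteqP; split.
Qed.

End LayerCake.

(** * The exponential martingale of one arm has expectation 1 *)

Section ExponentialMartingale.
Context (R : realType) (d : measure_display) (Omega : nat -> measurableType d)
  (P : forall n, probability (Omega n) R) (p : nat) (m : nat -> nat)
  (X : forall n, nat -> Omega n -> 'I_p) (Y : forall n, nat -> Omega n -> R)
  (Lambda : forall n : nat, seq ('I_p * R) -> 'I_p -> R)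
  (beta0 : 'rV[R]_p) (sigma : R).
Hypothesis sigma0 : 0 < sigma.
Hypothesis sampling : adaptive_gaussian_sampling P m X Y Lambda beta0 sigma.
Variable n : nat.

Lemma measurable_arm j a : measurable [set w | @X n j w = a].
Proof. by have [_ [mX _] _ _] := sampling n; exact: mX. Qed.

Lemma measurable_reward j : measurable_fun setT (@Y n j).
Proof. by have [_ [_ mY] _ _] := sampling n; exact: mY. Qed.

Let measurable_cylinder j a (C : set R) : measurable C ->
  measurable [set w | @X n j w = a /\ C (@Y n j w)].
Proof.
move=> mC; apply: measurableI; first exact: measurable_arm.
by rewrite -[X in measurable X]setTI; exact: measurable_reward.
Qed.

Lemma history_sigma_measurable j : history_sigma X Y (n := n) j `<=` measurable.
Proof.
apply: smallest_sub; first exact: sigma_algebra_measurable.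
by move=> _ [k [a [C [_ [mC ->]]]]]; exact: measurable_cylinder.
Qed.

Lemma measurable_arm_indic j a :
  measurable_fun setT (fun w => (@X n j w == a)%:R : R).
Proof.
rewrite (_ : (fun _ => _) = \1_[set w | @X n j w = a]).
  exact/measurable_indic/measurable_arm.
apply/funext => w; rewrite indicE; congr ((_ : bool)%:R).
by apply/eqP/idP; rewrite inE.
Qed.

Let measurable_Lambda j i :
  measurable_fun setT (fun w : Omega n => Lambda n (history X Y j w) i).
Proof.
have [_ _ mL _] := sampling n.
move=> _ B mB; rewrite setTI; apply: (history_sigma_measurable (j := j)).
exact: mL.
Qed.

(** The sampling rule describes the conditional law of the reward on events. Cutting [h] into
    superlevel sets extends it to nonnegative functions, here of mean 1 under the reward law of arm
    [i]. *)
Lemma reward_condition j i (h : R -> R) (A : set (Omega n)) : (j < m n)%N ->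
  (forall y, 0 <= h y) -> measurable_fun setT h ->
  (\int[lebesgue_measure]_y (h y * normal_pdf (beta0 ord0 i) sigma y)%:E = 1)%E ->
  history_sigma X Y (n := n) j A ->
  (\int[P n]_(w in A) ((@X n j w == i)%:R * h (@Y n j w))%:E =
   \int[P n]_(w in A) (Lambda n (history X Y j w) i)%:E)%E.
Proof.
move=> jm h0 mh h1 HA.
have [[L0 L1] _ _ cond] := sampling n.
have mA := history_sigma_measurable HA.
set c := RHS.
have c0 : (0 <= c)%E by apply: integral_ge0 => w _; rewrite lee_fin.
pose D := A `&` [set w | @X n j w = i].
have mD : measurable D by apply: measurableI => //; exact: measurable_arm.
have mhY : measurable_fun setT (fun w => h (@Y n j w)).
  by apply: measurableT_comp => //; exact: measurable_reward.
(* Absorbs the restriction to [A] and the draw of arm [i] into one indicator, so that each layer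
   becomes an event covered by the sampling rule. *)
transitivity (\int[P n]_w ((h (@Y n j w))%:E * (\1_D w)%:E))%E.
  rewrite integral_mkcond; apply: eq_integral => w _; rewrite /patch.
  rewrite /D indicE in_setI.
  case: ifP => _ /=; last by rewrite mule0.
  rewrite -EFinM mulrC; congr (_ * _)%:E; congr ((_ : bool)%:R).
  by apply/eqP/idP; rewrite inE.
have m1D : measurable_fun setT (fun w => (\1_D w)%:E : \bar R).
  exact/measurable_EFinP/measurable_indic.
rewrite layer_cake//.
pose S t := [set y : R | 0 <= t < h y].
have mS t : measurable (S t).
  have /(_ measurableT [set true]) : measurable_fun setT (fun y : R => (0 <= t) && (t < h y)).
    by apply: measurable_and => //; exact: measurable_fun_ltr.
  by rewrite setTI; apply.
transitivity (\int[lebesgue_measure]_t (c * normal_prob (beta0 ord0 i) sigma (S t)))%E.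
  apply: eq_integral => t _; rewrite -cond//.
  rewrite integral_indic//; last first.
    by rewrite -[X in measurable X]setTI; exact: (@measurable_reward j measurableT _ (mS t)).
  by congr (P n _); apply/seteqP; split => w /=; rewrite /D /S /=; tauto.
have mpdf : measurable_fun setT (fun y => (normal_pdf (beta0 ord0 i) sigma y)%:E).
  by apply/measurable_EFinP; exact: measurable_normal_pdf.
have pdf0 y : (0 <= (normal_pdf (beta0 ord0 i) sigma y)%:E)%E.
  by rewrite lee_fin normal_pdf_ge0.
transitivity (\int[lebesgue_measure]_t \int[lebesgue_measure]_(y in S t)
    (c * (normal_pdf (beta0 ord0 i) sigma y)%:E))%E.
  apply: eq_integral => t _; rewrite ge0_integralZl//.
    exact: mS.
  exact: measurable_funTS.
(* Layer cake in reverse, now on the real line, reassembles the mean of [h] under the normal law. *)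
rewrite -(@layer_cake _ _ _ lebesgue_measure h
  (fun y => c * (normal_pdf (beta0 ord0 i) sigma y)%:E)%E)//; last 2 first.
- by move=> y; rewrite mule_ge0.
- exact: measurable_funeM.
under eq_integral do rewrite muleCA -EFinM.
rewrite ge0_integralZl// ?h1 ?mule1//.
- apply/measurable_EFinP; apply: measurable_funM => //.
  exact: measurable_normal_pdf.
- by move=> y _; rewrite lee_fin mulr_ge0// normal_pdf_ge0.
Qed.

Variables (k : 'I_p) (l : R).

(** This is exp(l S_k - l^2 sigma^2 N_k / 2) after [j] draws, written as one sum over the draws so
    that a new draw contributes one factor. *)
Definition exp_mart j (w : Omega n) : R :=
  expR (\sum_(t < j) (@X n t w == k)%:R *
    (l * (@Y n t w - beta0 ord0 k) - l ^+ 2 * sigma ^+ 2 / 2)).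

Lemma measurable_exp_mart j : measurable_fun setT (exp_mart j).
Proof.
apply: measurableT_comp => //; apply: measurable_sum => t.
apply: measurable_funM; first exact: measurable_arm_indic.
apply: measurable_funB => //; apply: measurable_funM => //.
by apply: measurable_funB => //; exact: measurable_reward.
Qed.

Lemma exp_mart_adapted j (B : set R) : measurable B ->
  history_sigma X Y (n := n) j (exp_mart j @^-1` B).
Proof.
move=> mB; rewrite /history_sigma; set G := (X in <<s X >>).
have mcyl t a (C : set R) : (t < j)%N -> measurable C ->
    measurable ([set w | @X n t w = a /\ C (@Y n t w)] : set (g_sigma_algebraType G)).
  by move=> tj mC; apply: sub_sigma_algebra; exists t, a, C.
have mX t a : (t < j)%N ->
    measurable ([set w | @X n t w = a] : set (g_sigma_algebraType G)).
  move=> tj; rewrite (_ : [set w | _] = [set w | @X n t w = a /\ setT (@Y n t w)]).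
    exact: mcyl.
  by apply/seteqP; split => w //= -[].
have mY t : (t < j)%N -> measurable_fun setT (@Y n t : g_sigma_algebraType G -> R).
  move=> tj _ C mC; rewrite setTI.
  (* The generating events fix the arm as well as the reward, so a reward event is recovered as a
     finite union over the arms. *)
  rewrite (_ : _ @^-1` _ = \bigcup_(a in [set: 'I_p]) [set w | @X n t w = a /\ C (@Y n t w)]).
    by apply: fin_bigcup_measurable => // a _; exact: mcyl.
  apply/seteqP; split => [w /= Cw|w [a _ [_ Cw]]//]; exists (@X n t w) => //.
suff : measurable_fun setT (exp_mart j : g_sigma_algebraType G -> R).
  by move=> /(_ measurableT B mB); rewrite setTI.
apply: measurableT_comp => //; apply: measurable_sum => t.
apply: measurable_funM.
  rewrite (_ : (fun _ => _) = (\1_[set w | @X n t w = k] : g_sigma_algebraType G -> R)).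
    by apply: measurable_indic; exact: (mX t k (ltn_ord t)).
  apply/funext => w; rewrite indicE; congr ((_ : bool)%:R).
  by apply/eqP/idP; rewrite inE.
apply: measurable_funB => //; apply: measurable_funM => //.
by apply: measurable_funB => //; exact: (mY t (ltn_ord t)).
Qed.

(** Whichever arm is drawn, the new factor has conditional mean 1. Conditioning on the history thus
    replaces it by the sum of the probabilities [Lambda], which is 1 for every rule. *)
Lemma expectation_exp_mart j : (j <= m n)%N ->
  (\int[P n]_w (exp_mart j w)%:E = 1)%E.
Proof.
have [[L0 L1] _ _ _] := sampling n.
elim: j => [_|j IH jm].
  under eq_integral do rewrite /exp_mart big_ord0 expR0.
  by rewrite integral_cst//= probability_setT mule1.
(* The factor contributed by a draw of arm [i] with reward [y]. *)
pose h (i : 'I_p) (y : R) : R := if i == k then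
  expR (l * (y - beta0 ord0 k) - l ^+ 2 * sigma ^+ 2 / 2) else 1.
have h0 i y : 0 <= h i y by rewrite /h; case: ifP => _ //; exact: expR_ge0.
have mh i : measurable_fun setT (h i).
  rewrite /h; case: (i == k) => //.
  apply: measurableT_comp => //; apply: measurable_funB => //.
  by apply: measurable_funM => //; apply: measurable_funB.
have h1 i : (\int[lebesgue_measure]_y
    (h i y * normal_pdf (beta0 ord0 i) sigma y)%:E = 1)%E.
  rewrite /h; have [->|_] := eqVneq i k; last first.
    by under eq_integral do rewrite mul1r; exact: integral_normal_pdf.
  (* Multiplied by this factor, the reward density of arm [k] becomes the normal density with mean
     shifted by l sigma^2. *)
  rewrite -(integral_normal_pdf (beta0 ord0 k + l * sigma ^+ 2) sigma).
  apply: eq_integral => y _; congr EFin.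
  rewrite expRD mulrAC [expR _ * normal_pdf _ _ _]mulrC normal_pdf_tilt ?gt_eqF//.
  by rewrite subrr mulr0 add0r mulrAC -expRD subrr expR0 mul1r.
have W0 w : 0 <= exp_mart j w by exact: expR_ge0.
have mW := measurable_exp_mart j.
pose F i w : R := (@X n j w == i)%:R * h i (@Y n j w).
have F0 i w : 0 <= F i w by rewrite mulr_ge0.
have mF i : measurable_fun setT (F i).
  apply: measurable_funM; first exact: measurable_arm_indic.
  by apply: measurableT_comp => //; exact: measurable_reward.
(* Splits the new factor according to the arm drawn; exactly one summand is nonzero. *)
transitivity (\int[P n]_w \sum_(i < p) ((exp_mart j w)%:E * (F i w)%:E))%E.
  apply: eq_integral => w _; under eq_bigr do rewrite -EFinM.
  rewrite sumEFin -mulr_sumr; congr EFin; rewrite /exp_mart big_ord_recr /= expRD.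
  congr (_ * _); rewrite (bigD1 (@X n j w))//= big1 ?addr0; last first.
    by move=> i iX; rewrite /F eq_sym (negbTE iX) mul0r.
  by rewrite /F /h eqxx mul1r; case: eqP => _; rewrite ?mul1r ?mul0r ?expR0.
rewrite ge0_integral_sum//; last 2 first.
- by move=> i; apply: emeasurable_funM; exact/measurable_EFinP.
- by move=> i w _; rewrite mule_ge0// lee_fin.
transitivity (\sum_(i < p) \int[P n]_w ((exp_mart j w)%:E *
    (Lambda n (history X Y j w) i)%:E))%E.
  apply: eq_bigr => i _.
  apply: (@eq_integral_subsigma _ _ _ (P n) _ (fun w => (F i w)%:E)
    (fun w => (Lambda n (history X Y j w) i)%:E) (exp_mart j)) => //.
  - by move=> w; rewrite lee_fin.
  - exact/measurable_EFinP.
  - by move=> w; rewrite lee_fin.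
  - by apply/measurable_EFinP; exact: measurable_Lambda.
  - exact: exp_mart_adapted.
  - by move=> A; exact: reward_condition.
rewrite -ge0_integral_sum//; last 2 first.
- by move=> i; apply: emeasurable_funM; apply/measurable_EFinP;
    [exact: mW|exact: measurable_Lambda].
- by move=> i w _; rewrite mule_ge0// lee_fin.
rewrite -[RHS]IH ?(ltnW jm)//; apply: eq_integral => w _.
by under eq_bigr do rewrite -EFinM; rewrite sumEFin -mulr_sumr L1 mulr1.
Qed.

End ExponentialMartingale.

(** * Tail bounds for the arm means and measurability of the posterior event *)

Section PosteriorEvents.
Context (R : realType) (d : measure_display) (Omega : nat -> measurableType d)
  (P : forall n, probability (Omega n) R) (p : nat) (m : nat -> nat)
  (X : forall n, nat -> Omega n -> 'I_p) (Y : forall n, nat -> Omega n -> R)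
  (Lambda : forall n : nat, seq ('I_p * R) -> 'I_p -> R)
  (beta0 : 'rV[R]_p) (sigma : R).
Hypothesis sigma0 : 0 < sigma.
Hypothesis sampling : adaptive_gaussian_sampling P m X Y Lambda beta0 sigma.
Variable n : nat.
Implicit Types (w : Omega n) (k : 'I_p).

(** With this indexing [design R m X w] is convertible to [onehot R (arms w)], so the results on
    one-hot designs apply to [gram] and [ols] directly. *)
Definition arms w (j : 'I_(m n)) : 'I_p := @X n j w.
Definition pulls k w : R := arm_count R (arms w) k.
Definition deviation k w : R :=
  \sum_(j < m n) (@X n j w == k)%:R * (@Y n j w - beta0 ord0 k).

Lemma measurable_pulls k : measurable_fun setT (pulls k).
Proof. by apply: measurable_sum => j; exact: (measurable_arm_indic sampling). Qed.

Lemma measurable_deviation k : measurable_fun setT (deviation k).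
Proof.
apply: measurable_sum => j; apply: measurable_funM.
  exact: (measurable_arm_indic sampling).
by apply: measurable_funB => //; exact: (measurable_reward sampling).
Qed.

(** The arm sequence takes finitely many values, so any predicate of it defines an event. This
    covers invertibility of the Gram matrix and bounds on [lambda_min] at once. *)
Lemma measurable_arms (Q : ('I_(m n) -> 'I_p) -> Prop) :
  measurable [set w | Q (arms w)].
Proof.
rewrite (_ : [set w | _] = \bigcup_(x in [set x : {ffun 'I_(m n) -> 'I_p} | Q x])
    \bigcap_(j in [set: 'I_(m n)]) [set w | @X n j w = x j]).
  apply: fin_bigcup_measurable => // x _.
  by apply: fin_bigcap_measurable => // j _; exact: (measurable_arm sampling).
apply/seteqP; split => w /=.
  move=> Qw; exists [ffun j => arms w j] => /=.
    by have -> : [ffun j => arms w j] = arms w :> (_ -> _)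
      by apply/funext => j; rewrite ffunE.
  by move=> j _ /=; rewrite ffunE.
move=> [x /= Qx xw]; rewrite (_ : arms w = x)//.
by apply/funext => j; exact: xw.
Qed.

Lemma arm_mean_deviation k w : 0 < pulls k w ->
  arm_mean (arms w) (response m Y w) k - beta0 ord0 k = deviation k w / pulls k w.
Proof.
move=> N0; apply: (mulIf (lt0r_neq0 N0)); rewrite divfK ?gt_eqF//.
rewrite mulrBl /arm_mean divfK ?gt_eqF// /arm_sum /pulls /arm_count mulr_sumr -sumrB.
by apply: eq_bigr => j _; rewrite mxE /arms mulrBr [beta0 _ _ * _]mulrC.
Qed.

(* Markov's inequality for the exponential martingale at l = e delta / sigma^2, the
   minimiser over l of the resulting exponent. *)
Lemma deviation_tail k (delta L e : R) : 0 < delta -> e ^+ 2 = 1 ->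
  (P n [set w | (L <= pulls k w)%R && (delta * pulls k w < e * deviation k w)%R]
   <= (expR (- (delta ^+ 2 / (sigma ^+ 2 *+ 2) * L)))%:E)%E.
Proof.
move=> d0 e1; set E := [set w | _]; set c := _ * L.
have mE : measurable E.
  have /(_ measurableT [set true]) : measurable_fun setT
      (fun w => (L <= pulls k w) && (delta * pulls k w < e * deviation k w)).
    apply: measurable_and.
      by apply: measurable_fun_ler => //; exact: measurable_pulls.
    apply: measurable_fun_ltr; apply: measurable_funM => //.
      exact: measurable_pulls.
    exact: measurable_deviation.
  by rewrite setTI; apply.
pose l := e * (delta / sigma ^+ 2).
have -> : P n E = (\int[P n]_w (\1_E w)%:E)%E by rewrite integral_indic// setIT.
(* On [E] the martingale's exponent is at least (delta^2/sigma^2) N_k - (delta^2/(2 sigma^2)) N_k,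
   which is at least [c] because N_k >= L. *)
apply: (@le_trans _ _ (\int[P n]_w ((expR (- c))%:E *
    (exp_mart X Y beta0 sigma k l (m n) w)%:E))%E).
  apply: ge0_le_integral => //.
  - by apply/measurable_EFinP; exact: measurable_indic.
  - apply: emeasurable_funM => //; apply/measurable_EFinP.
    exact: (measurable_exp_mart sampling).
  move=> w _; rewrite -EFinM lee_fin indicE.
  case: (boolP (w \in E)) => [|_]; last by rewrite mulr_ge0// expR_ge0.
  rewrite inE => /andP[LN dN]; rewrite /exp_mart -expRD -[leLHS]expR0 ler_expR.
  have -> : \sum_(t < m n) (X t w == k)%:R *
      (l * (Y t w - beta0 ord0 k) - l ^+ 2 * sigma ^+ 2 / 2) =
      l * deviation k w - l ^+ 2 * sigma ^+ 2 / 2 * pulls k w.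
    rewrite /deviation /pulls /arm_count !mulr_sumr -sumrB; apply: eq_bigr => t _.
    by rewrite /arms; ring.
  have s2 : 0 < sigma ^+ 2 by rewrite exprn_gt0.
  have q0 : 0 < delta / sigma ^+ 2 by rewrite divr_gt0.
  have -> : l * deviation k w = delta / sigma ^+ 2 * (e * deviation k w).
    by rewrite /l; ring.
  have -> : l ^+ 2 * sigma ^+ 2 / 2 = delta ^+ 2 / (sigma ^+ 2 *+ 2).
    by rewrite /l exprMn e1; field; rewrite gt_eqF.
  have h1 : delta / sigma ^+ 2 * (delta * pulls k w) <=
      delta / sigma ^+ 2 * (e * deviation k w) by rewrite ler_pM2l// ltW.
  have h2 : c <= delta ^+ 2 / (sigma ^+ 2 *+ 2) * pulls k w.
    by rewrite /c ler_wpM2l// divr_ge0 ?sqr_ge0// mulrn_wge0// ltW.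
  have h3 : delta / sigma ^+ 2 * (delta * pulls k w) =
      delta ^+ 2 / (sigma ^+ 2 *+ 2) * pulls k w +
      delta ^+ 2 / (sigma ^+ 2 *+ 2) * pulls k w.
    by field; rewrite gt_eqF.
  lra.
rewrite ge0_integralZl//.
- by rewrite (expectation_exp_mart sigma0 sampling)// mule1.
- by apply/measurable_EFinP; exact: (measurable_exp_mart sampling).
- by move=> w _; rewrite lee_fin expR_ge0.
Qed.

Variable prior : 'rV[R]_p -> R.
Hypothesis prior_cont : continuous prior.
Hypothesis prior_bound : exists K : R, forall b, `|prior b| <= K.
Hypothesis prior_ge0 : forall b, 0 <= prior b.
Hypothesis prior1 : Rp_integral (fun b => (prior b)%:E) = 1%E.

Let L w := likelihood sigma (design R m X w) (response m Y w).

Let L_gt0 w b : 0 < L w b.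
Proof. by apply: prodr_gt0 => j _; exact: expR_gt0. Qed.

Let measurable_L :
  measurable_fun setT (fun z : Omega n * p.-tuple R => L z.1 (tup2row z.2)).
Proof.
rewrite (_ : (fun _ => _) = fun z : Omega n * p.-tuple R => \prod_(j < m n)
  expR (- (@Y n j z.1 - \sum_k (@X n j z.1 == k)%:R * tup2row z.2 ord0 k) ^+ 2 /
    (sigma ^+ 2 *+ 2))).
  apply: measurable_prod => j _; apply: measurableT_comp => //.
  apply: measurable_funM => //; apply: measurableT_comp => //.
  apply: measurable_funX; apply: measurable_funB.
    exact: (measurableT_comp (measurable_reward sampling j) measurable_fst).
  apply: measurable_sum => k; apply: measurable_funM.
    exact: (measurableT_comp (measurable_arm_indic sampling j k) measurable_fst).
  exact: (measurableT_comp (@measurable_tup2row_coord R p k) measurable_snd).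
apply/funext => z; apply: eq_bigr => j _; rewrite !mxE.
congr (expR (- (_ - _) ^+ 2 / _)); apply: eq_bigr => k _; rewrite !mxE.
by [].
Qed.

Let unit_pulls w : gram R m X w \in unitmx -> forall k, 0 < pulls k w.
Proof. by rewrite (onehot_gram_unit R (arms w)) => /forallP. Qed.

Section UnitGram.
Variable w : Omega n.
Hypothesis Gu : gram R m X w \in unitmx.

Let g := gauss_prod (arm_mean (arms w) (response m Y w)) (arm_sd (arms w) sigma).

Let N0 k : 0 < arm_count R (arms w) k. Proof. exact: unit_pulls. Qed.

Let g_gt0 b : 0 < g b.
Proof. by apply: gauss_prod_gt0 => k; rewrite gt_eqF// arm_sd_gt0. Qed.

Lemma gauss_density_ols :
  gauss_density (ols m X Y w) (sigma ^+ 2 *: invmx (gram R m X w)) = g.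
Proof. by apply/funext => b; exact: (gauss_density_onehot _ N0 sigma0). Qed.

Let mg : measurable_fun setT (g \o @tup2row R p).
Proof. exact: measurable_gauss_prod. Qed.

Let priorg : (0 < Rp_integral (fun b => (prior b * g b)%:E) < +oo)%E.
Proof.
have [K bK] := prior_bound; apply: (tilted_normalizer bK) => //.
  exact: measurable_continuous_tup2row.
by rewrite Rp_integral_gauss_prod ltry.
Qed.

Let LE : exists2 C, 0 < C & L w = (fun b => C * g b).
Proof.
have [C C0 LC] := likelihood_onehot (response m Y w) N0 sigma0.
by exists C => //; apply/funext => b; exact: LC.
Qed.

Lemma posterior_tilted :
  posterior sigma prior (design R m X w) (response m Y w) = tilted prior g.
Proof.
have [C C0 LC] := LE.
rewrite -(@tiltedZ _ _ prior g C)//; first by rewrite -LC.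
- by move=> b; exact: ltW.
- exact: measurable_continuous_tup2row.
- by case/andP: priorg.
Qed.

(** The Gaussian approximation is the posterior for a flat prior. Both densities thus become tilts
    of the same likelihood, as [measurable_tv_dist_tilted] requires. *)
Lemma tilted1_likelihood : tilted (fun=> 1) (L w) = g.
Proof.
have [C C0 ->] := LE.
rewrite tiltedZ//.
- by rewrite tilted1// Rp_integral_gauss_prod.
- by move=> b; exact: ltW.
- exact: measurable_cst.
- under [X in Rp_integral X]eq_fun do rewrite mul1r.
  by rewrite Rp_integral_gauss_prod ltry.
Qed.

Lemma Rp_integral_likelihood :
  (0 < Rp_integral (fun b => (L w b)%:E) < +oo)%E.
Proof.
have [C C0 ->] := LE; rewrite Rp_integralZl ?(ltW C0)//.
  by rewrite Rp_integral_gauss_prod mule1 lte_fin C0 ltry.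
by move=> b; exact: ltW.
Qed.

Lemma Rp_integral_prior_likelihood :
  (0 < Rp_integral (fun b => (prior b * L w b)%:E) < +oo)%E.
Proof.
have [K bK] := prior_bound; apply: (tilted_normalizer bK) => //.
- exact: measurable_continuous_tup2row.
- exact: (measurableT_comp measurable_L (@pair1_measurable _ _ _ (p.-tuple R) w)).
- by case/andP: Rp_integral_likelihood.
Qed.

End UnitGram.

Lemma measurable_tv_event (eps : R) :
  measurable [set w : Omega n | ~~ (gram R m X w \in unitmx) \/
    (eps%:E < tv_dist
       (posterior sigma prior (design R m X w) (response m Y w))
       (gauss_density (ols m X Y w) (sigma ^+ 2 *: invmx (gram R m X w))))%E].
Proof.
set D := [set w : Omega n | gram R m X w \in unitmx].
have mD : measurable D.
  exact: (measurable_arms (fun x => (onehot R x)^T *m onehot R x \in unitmx)).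
rewrite (_ : [set w | _] = ~` D `|` (D `&`
  [set w | (eps%:E < tv_dist (tilted prior (L w)) (tilted (fun=> 1%R) (L w)))%E])).
  apply: measurableU; first exact: measurableC.
  apply: measurable_tv_dist_tilted => //.
  - exact: measurable_continuous_tup2row.
  - exact: Rp_integral_prior_likelihood.
  - exact: Rp_integral_likelihood.
apply/seteqP; split => w /=.
  have [Dw|nDw] := boolP (gram R m X w \in unitmx); last by move=> _; left; exact/negP.
  by case=> //; rewrite gauss_density_ols// -tilted1_likelihood//; right.
move=> [nDw|[Dw]]; first by left; exact/negP.
by rewrite tilted1_likelihood// -gauss_density_ols//; right.
Qed.

End PosteriorEvents.

(** * Convergence of probabilities to 0, and the finite union bound *)

Section ConvergenceInProbability.
Context (R : realType) (d : measure_display) (Omega : nat -> measurableType d)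
  (P : forall n, probability (Omega n) R).

Lemma cvg_probability0P (E : forall n, set (Omega n)) :
  (fun n => P n (E n)) @ \oo --> 0%E <->
  forall e : R, 0 < e -> \forall n \near \oo, (P n (E n) <= e%:E)%E.
Proof.
split => [|H].
  move=> /fine_cvgP[fin /cvgrPdist_le H] e e0.
  near=> n.
  have fn : P n (E n) \is a fin_num by near: n.
  rewrite -(fineK fn) lee_fin (le_trans (ler_norm _))// -normrN -sub0r.
  by near: n; exact: H.
apply/fine_cvgP; split.
  near=> n; rewrite ge0_fin_numE//.
  have : (P n (E n) <= 1%:E)%E by near: n; exact: H.
  by move=> /le_lt_trans; apply; rewrite ltry.
apply/cvgrPdist_le => e e0; near=> n.
have Pe : (P n (E n) <= e%:E)%E by near: n; exact: H.
have fn : P n (E n) \is a fin_num.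
  by rewrite ge0_fin_numE// (le_lt_trans Pe) ?ltry.
by rewrite sub0r normrN ger0_norm ?fine_ge0// -lee_fin fineK.
Unshelve. all: by end_near. Qed.

End ConvergenceInProbability.

Lemma le_measure_bigsetU d (T : measurableType d) (R : realType)
    (mu : {measure set T -> \bar R}) (I : Type) (r : seq I) (F : I -> set T) :
  (forall i, measurable (F i)) ->
  (mu (\big[setU/set0]_(i <- r) F i) <= \sum_(i <- r) mu (F i))%E.
Proof.
move=> mF; elim: r => [|i r IH]; first by rewrite !big_nil measure0.
rewrite !big_cons; apply: (le_trans (measureU2 _ _ _)) => //.
  exact: bigsetU_measurable.
exact: leeD.
Qed.

(** * Bound on the probability of a large total variation distance, and its limit *)

Section Posterior.
Context (R : realType) (d : measure_display) (Omega : nat -> measurableType d)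
  (P : forall n, probability (Omega n) R) (p : nat) (m : nat -> nat)
  (X : forall n, nat -> Omega n -> 'I_p) (Y : forall n, nat -> Omega n -> R)
  (Lambda : forall n : nat, seq ('I_p * R) -> 'I_p -> R)
  (beta0 : 'rV[R]_p) (sigma : R) (prior : 'rV[R]_p -> R).
Hypothesis sigma0 : 0 < sigma.
Hypothesis sampling : adaptive_gaussian_sampling P m X Y Lambda beta0 sigma.
Hypothesis prior_cont : continuous prior.
Hypothesis prior_bound : exists K : R, forall b, `|prior b| <= K.
Hypothesis prior_ge0 : forall b, 0 <= prior b.
Hypothesis prior1 : Rp_integral (fun b => (prior b)%:E) = 1%E.
Hypothesis prior_gt0 : 0 < prior beta0.

(** If [lambda_min] exceeds [M], so does every pull count. If moreover every arm mean is within
    [delta] of the truth, the Gram matrix is invertible and the distance is at most [eps]. The last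
    term is a union bound over [p] arms and two signs, with constants uniform in [n]. *)
Lemma tv_event_bound (eps : R) : 0 < eps ->
  exists c M0 : R, [/\ 0 < c, 0 < M0 & forall n M, M0 <= M ->
  (P n [set w | ~~ (gram R m X w \in unitmx) \/
        (eps%:E < tv_dist
           (posterior sigma prior (design R m X w) (response m Y w))
           (gauss_density (ols m X Y w) (sigma ^+ 2 *: invmx (gram R m X w))))]
   <= P n [set w | (lambda_min (gram R m X w) <= M)%R] +
      (p%:R * (expR (- (c * M)) *+ 2))%:E)%E].
Proof.
move=> eps0.
have [delta [V [d0 V0 tvle]]] :=
  tv_dist_tilted_gauss_prod prior_cont prior_bound prior_ge0 prior_gt0 eps0.
have s2 : 0 < sigma ^+ 2 by rewrite exprn_gt0.
(* The first witness is the rate in [deviation_tail]; the second makes each variance sigma^2 / N_k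
   at most [V] once N_k > M. *)
exists (delta ^+ 2 / (sigma ^+ 2 *+ 2)), (sigma ^+ 2 / V).
split; [by rewrite divr_gt0 ?exprn_gt0// mulrn_wgt0|by rewrite divr_gt0|].
move=> n M M0.
set bad := [set w | _ \/ _]; set low := [set w | (_ <= M)%R].
have Mgt0 : 0 < M by apply: lt_le_trans M0; rewrite divr_gt0.
pose dev e k := [set w : Omega n | (M <= pulls R m X k w) &&
   (delta * pulls R m X k w < e * deviation m X Y beta0 k w)].
have mdev e k : measurable (dev e k).
  have /(_ measurableT [set true]) : measurable_fun setT
      (fun w : Omega n => (M <= pulls R m X k w) &&
        (delta * pulls R m X k w < e * deviation m X Y beta0 k w)).
    apply: measurable_and.
      by apply: measurable_fun_ler => //; exact: (measurable_pulls sampling).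
    apply: measurable_fun_ltr; apply: measurable_funM => //.
      exact: (measurable_pulls sampling).
    exact: (measurable_deviation sampling).
  by rewrite setTI; apply.
have mlow : measurable low.
  exact: (measurable_arms sampling
    (fun x => lambda_min ((onehot R x)^T *m onehot R x) <= M)).
pose devs := \big[setU/set0]_(k < p) (dev 1 k `|` dev (-1) k).
have mdevs : measurable devs.
  by apply: bigsetU_measurable => k _; exact: measurableU.
have sub : bad `<=` low `|` devs.
  move=> w badw; have [|] := pselect (low w); [by left|].
  rewrite /low /= => /negP; rewrite -ltNge => hiw; right.
  have MN k : M < pulls R m X k w.
    by apply: (lt_le_trans hiw); exact: (lambda_min_onehot_gram R (@arms d Omega p m X n w)).
  have N0 k : 0 < pulls R m X k w by exact: lt_trans (MN k).
  apply: contrapT => ndevs.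
  have ndev e k : e = 1 \/ e = -1 ->
      e * deviation m X Y beta0 k w <= delta * pulls R m X k w.
    move=> he; rewrite leNgt; apply/negP => dk; apply: ndevs.
    rewrite /devs -bigcup_seq; exists k; first by rewrite /= mem_index_enum.
    by case: he dk => ->; [left|right]; rewrite /dev /= (ltW (MN k)).
  case: badw.
    rewrite (onehot_gram_unit R (@arms d Omega p m X n w)) => /negP; apply; apply/forallP => k.
    exact: N0.
  have Gu : gram R m X w \in unitmx.
    by rewrite (onehot_gram_unit R (@arms d Omega p m X n w)); apply/forallP => k; exact: N0.
  rewrite (gauss_density_ols _ sigma0 Gu).
  rewrite (posterior_tilted Y sigma0 prior_cont prior_bound prior_ge0 prior1 Gu).
  rewrite ltNge => /negP; apply; apply: tvle.
  - by move=> k; rewrite gt_eqF// arm_sd_gt0.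
  - move=> k; rewrite sqr_arm_sd// ler_pdivrMr//; last exact: N0.
    have := MN k; rewrite /pulls => /ltW MNk.
    by rewrite mulrC -ler_pdivrMr// (le_trans M0).
  - move=> k; rewrite (arm_mean_deviation Y beta0 (N0 k)) normrM normfV.
    rewrite (gtr0_norm (N0 k)) ler_pdivrMr ?N0// ler_norml.
    have := ndev 1 k (or_introl erefl); have := ndev (-1) k (or_intror erefl).
    by rewrite mul1r mulN1r => *; apply/andP; split; lra.
apply: (@le_trans _ _ (P n (low `|` devs))).
  apply: le_measure => //; rewrite inE; last exact: measurableU.
  exact: (measurable_tv_event sigma0 sampling).
apply: (le_trans (measureU2 _ _ _)) => //; apply: leeD => //.
apply: (@le_trans _ _ (\sum_(k < p) P n (dev 1%R k `|` dev (-1)%R k))%E).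
  by apply: le_measure_bigsetU => k; exact: measurableU.
have -> : (p%:R * (expR (- (delta ^+ 2 / (sigma ^+ 2 *+ 2) * M)) *+ 2) =
   \sum_(k < p) (expR (- (delta ^+ 2 / (sigma ^+ 2 *+ 2) * M)) *+ 2)).
  by rewrite sumr_const card_ord -[RHS]mulr_natl.
rewrite -sumEFin; apply: lee_sum => k _.
apply: (le_trans (measureU2 _ _ _)) => //; rewrite mulr2n EFinD.
by apply: leeD; apply: (deviation_tail sigma0 sampling) => //;
  rewrite ?sqrrN expr1n.
Qed.

End Posterior.

Unset Implicit Arguments.

Theorem theorem2 (R : realType) (d : measure_display) (Omega : nat -> measurableType d)
  (P : forall n, probability (Omega n) R) (p : nat) (m : nat -> nat)
  (X : forall n, nat -> Omega n -> 'I_p) (Y : forall n, nat -> Omega n -> R)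
  (Lambda : forall n, seq ('I_p * R) -> 'I_p -> R)
  (beta0 : 'rV[R]_p) (sigma : R) (prior : 'rV[R]_p -> R) :
  0 < sigma ->
  adaptive_gaussian_sampling P m X Y Lambda beta0 sigma ->
  (* (ii) lambda_min(X_n^T X_n) -> infinity in probability *)
  (forall M : R,
     (fun n => P n [set w | lambda_min (gram R m X w) <= M]) @ \oo --> 0%E) ->
  (* (iii) prior: continuous bounded density with prior(beta0) > 0 *)
  continuous prior ->
  (exists K : R, forall b, `|prior b| <= K) ->
  (forall b, 0 <= prior b) ->
  Rp_integral (fun b => (prior b)%:E) = 1%E ->
  0 < prior beta0 ->
  forall eps : R, 0 < eps ->
    (fun n => P n [set w | ~~ (gram R m X w \in unitmx) \/
        (eps%:E < tv_dist
           (posterior sigma prior (design R m X w) (response m Y w))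
           (gauss_density (ols m X Y w) (sigma ^+ 2 *: invmx (gram R m X w))))%E])
    @ \oo --> 0%E.
Proof.
move=> sigma0 sampling lamcvg pc pb p0 p1 pg eps eps0.
apply/cvg_probability0P => e e0.
have [c [M0 [c0 M00 bound]]] := tv_event_bound sigma0 sampling pc pb p0 p1 pg eps0.
(* From exp(cM) >= 1 + cM, the second bound makes the tail 2 p exp(-cM) at most e/2. As [M] does not
   depend on [n], the assumption on [lambda_min] at this one level supplies the other half. *)
pose M := Num.max M0 (p%:R * 4 / (e * c)).
have MM0 : M0 <= M by rewrite le_max lexx.
have tail : p%:R * (expR (- (c * M)) *+ 2) <= e / 2.
  have cM : 0 < 1 + c * M by rewrite ltr_pwDl// mulr_ge0 ?(ltW c0)// (le_trans (ltW M00)).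
  rewrite expRN (_ : _ * _ = p%:R * 2 / expR (c * M)); last by ring.
  rewrite ler_pdivrMr ?expR_gt0//.
  apply: (@le_trans _ _ (e / 2 * (1 + c * M))); last first.
    by rewrite ler_pM2l ?divr_gt0// expR_ge1Dx.
  have : p%:R * 4 / (e * c) <= M by rewrite le_max lexx orbT.
  rewrite ler_pdivrMr ?mulr_gt0// => h.
  by rewrite mulrDr mulr1; lra.
have /(_ M)/cvg_probability0P/(_ (e / 2)) := lamcvg.
rewrite divr_gt0// => /(_ isT); apply: filterS => n low.
apply: (le_trans (bound n M MM0)).
by rewrite [e]splitr EFinD leeD// lee_fin.
Qed.
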